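(* Let $d,n,m\in\mathbb{N}$, let $(a_{ij})\in\mathbb{Z}^{n\times m}$ be such that for each $i\in\{1,\ldots,n\}$ the integers $a_{i1},\ldots,a_{im}$ are relatively prime, and let $\alpha_1,\ldots,\alpha_n\in\mathbb{R}$ satisfy $\sum_{i=1}^n\alpha_i=0$. Suppose that for all independent $\mathbb{Z}^d$-valued random variables $U_1,\ldots,U_m$, $$\sum_{i=1}^n \alpha_i H\Big(\sum_{j=1}^m a_{ij}U_j\Big)\le 0 .$$ Then for all independent $\mathbb{R}^d$-valued continuous random variables $X_1,\ldots,X_m$, $$\sum_{i=1}^n \alpha_i h\Big(\sum_{j=1}^m a_{ij}X_j\Big)\le 0 .$$
   Context: $H(U)=\sum_u P(U=u)\log\frac{1}{P(U=u)}$ is the Shannon entropy of a discrete random variable; $h(X)=\int f_X\log\frac1{f_X}$ is the differential entropy of a random vector with density $f_X$ (w.r.t. Lebesgue measure). ''Continuous'' means having a distribution absolutely continuous w.r.t. Lebesgue measure. Standing assumption: all (Shannon and differential) entropies appearing are assumed to exist and be finite. *)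

(* Defs.v *)
From HB Require Import structures.
From mathcomp Require Import all_boot all_order all_algebra.
From mathcomp Require Import all_classical all_reals all_analysis.
Set Implicit Arguments. Unset Strict Implicit. Unset Printing Implicit Defensive.
Import Order.TTheory GRing.Theory Num.Theory.
Import numFieldNormedType.Exports.
Local Open Scope classical_set_scope.
Local Open Scope ring_scope.

Definition BorelRd (R : realType) (d : nat) :=
  g_sigma_algebraType (@open 'rV[R]_d).

(** [lam] is Lebesgue measure on R^d: a measure on the Borel sets of R^d
    giving every closed box  prod_k [a_k, b_k]  its volume  prod_k (b_k - a_k).
    (Such a measure exists and is unique.) *)
Definition lebesgue_Rd (R : realType) (d : nat)
    (lam : {measure set (BorelRd R d) -> \bar R}) : Prop :=
  forall a b : 'rV[R]_d, (forall k, a 0 k <= b 0 k) ->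
    lam [set x : 'rV[R]_d | forall k, a 0 k <= x 0 k <= b 0 k]
      = (\prod_(k < d) (b 0 k - a 0 k))%:E.

Definition mutually_independent {dT} {T : measurableType dT} {R : realType}
    (P : probability T R) {V : Type} (M : set (set V)) (m : nat)
    (X : 'I_m -> T -> V) : Prop :=
  forall B : 'I_m -> set V, (forall j, M (B j)) ->
    P (\bigcap_(j in [set: 'I_m]) (X j @^-1` B j))
      = (\prod_(j < m) P (X j @^-1` B j))%E.

Definition discrete_rv {dT} {T : measurableType dT} {d : nat}
    (U : T -> 'rV[int]_d) : Prop :=
  forall z : 'rV[int]_d, measurable (U @^-1` [set z]).

(** Shannon entropy  H(U) = sum_u P(U=u) log (1 / P(U=u))  (natural log;
    the terms with P(U=u)=0 vanish). *)
Definition shannon_entropy {dT} {T : measurableType dT} {R : realType}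
    (P : probability T R) {d : nat} (U : T -> 'rV[int]_d) : \bar R :=
  esum [set: 'rV[int]_d]
    (fun z => let p := fine (P (U @^-1` [set z])) in (p * ln (p^-1))%:E).

Definition borel_rv {dT} {T : measurableType dT} {R : realType} {d : nat}
    (X : T -> 'rV[R]_d) : Prop :=
  measurable_fun [set: T] (X : T -> BorelRd R d).

Definition abs_continuous_rv {dT} {T : measurableType dT} {R : realType} {d : nat}
    (lam : {measure set (BorelRd R d) -> \bar R}) (P : probability T R)
    (X : T -> 'rV[R]_d) : Prop :=
  forall B : set (BorelRd R d), measurable B -> lam B = 0%E ->
    P (X @^-1` B) = 0%E.

Definition is_density {dT} {T : measurableType dT} {R : realType} {d : nat}
    (lam : {measure set (BorelRd R d) -> \bar R}) (P : probability T R)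
    (X : T -> 'rV[R]_d) (f : 'rV[R]_d -> R) : Prop :=
  [/\ measurable_fun [set: BorelRd R d] (f : BorelRd R d -> R),
      (forall x, 0 <= f x) &
      forall B : set (BorelRd R d), measurable B ->
        P (X @^-1` B) = (\int[lam]_(x in B) (f x)%:E)%E].

Definition diff_entropy_is {dT} {T : measurableType dT} {R : realType} {d : nat}
    (lam : {measure set (BorelRd R d) -> \bar R}) (P : probability T R)
    (X : T -> 'rV[R]_d) (h : R) : Prop :=
  exists f : 'rV[R]_d -> R,
    [/\ is_density lam P X f,
        lam.-integrable [set: BorelRd R d]
          (fun x : BorelRd R d => (f x * ln (f x)^-1)%:E) &
        h%:E = (\int[lam]_(x in [set: BorelRd R d]) (f x * ln (f x)^-1)%:E)%E].

(* Main.v *)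
Require Import Defs.
From HB Require Import structures.
From mathcomp Require Import all_boot all_order all_algebra.
From mathcomp Require Import all_classical all_reals all_analysis.
From mathcomp Require Import measurable_realfun.
From mathcomp Require Import zify ring lra.
Import Order.TTheory GRing.Theory Num.Theory.
Import numFieldNormedType.Exports.
Local Open Scope classical_set_scope.
Local Open Scope ring_scope.
Set Implicit Arguments. Unset Strict Implicit. Unset Printing Implicit Defensive.

(* Idea. Put U_j = floor(k X_j). Since sum_i alpha_i = 0, the discrete inequality for the U_j
   passes to the limit as soon as H(sum_j a_ij U_j) - d ln k --> h(sum_j a_ij X_j) for every i.

   Suppose first that the X_j have bounded densities with compact support. An integrable density
   is L1-close to a Lipschitz function, so the law of U_j is almost invariant, in total variation,
   under any fixed integer shift once k is large. By independence and Bezout's identity the law of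
   W = sum_j a_ij U_j is almost invariant too; this is where coprimality is used. The same holds
   for Z = floor(k sum_j a_ij X_j), and |Z - W| is bounded by a constant independent of k;
   averaging over the shifts in a large cube then shows that Z and W are close in total variation.
   Both laws have point masses O(k^-d), hence the uniform continuity of t ln(1/t) makes H(W) - d ln k
   converge to the differential entropy.

   In general, condition on the event that every X_j lies in a large cube and has a bounded value
   of its density there. This keeps the X_j independent, and the density of sum_j a_ij X_j changes
   little in L1 while being at most twice the original one, so its entropy converges by domination.

   Lebesgue measure enters only through the volume k^-d of the grid cells. *)

(** Coprimality cannot be dropped: doubling an integer variable keeps its entropy, whereas h(2X) =
    h(X) + d ln 2; the law of 2U lives on a sublattice and is never almost invariant under a unit
    shift.

    The density of sum_j a_ij X_j is never computed as a convolution. Under the given probability it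
    is part of the hypothesis on the differential entropy, under the conditioned one it comes from
    Radon-Nikodym, and its upper bound is read off from the masses of grid cells.

    Such a bound holds only almost everywhere, while the estimates for [eta] need it at every point.
    Replacing a density by its minimum with the bound changes no integral and removes this
    difficulty.

    The discrete inequality is applied to the conditioned probability, not to the given one. The
    truncation level is fixed before k grows, because the bounds on densities and the number of
    cells per unit k^d depend on it. *)

(** * The function t ln (1/t), integer cubes and finite products *)

Section eta.
Context {R : realType}.
Implicit Types s t c e M : R.

Definition eta t : R := t * ln t^-1.

Lemma eta0 : eta 0 = 0. Proof. by rewrite /eta mul0r. Qed.

(** The form [t * ln t^-1] of [eta] is that of the summand of [shannon_entropy] and of the integrand
    of [diff_entropy_is], so both unfold to it; this is the usual form for positive arguments. *)
Lemma etaE t : 0 < t -> eta t = - (t * ln t).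
Proof. by move=> t0; rewrite /eta lnV ?posrE// mulrN. Qed.

Lemma etaM s t : 0 <= s -> 0 <= t -> eta (s * t) = s * eta t + t * eta s.
Proof.
rewrite le_eqVlt => /predU1P[<- _|s0]; first by rewrite mul0r eta0 mul0r mulr0 addr0.
rewrite le_eqVlt => /predU1P[<-|t0]; first by rewrite mulr0 eta0 mul0r mulr0 addr0.
rewrite !etaE ?mulr_gt0// lnM ?posrE//; ring.
Qed.

Lemma eta_le2 s : 0 <= s <= 2 -> `|eta s| <= 2.
Proof.
move=> /andP[]; rewrite le_eqVlt => /predU1P[<- _|s0 s2]; first by rewrite eta0 normr0.
have l1 : ln s <= s - 1 by have := @le_ln1Dx R (s - 1); rewrite addrCA subrr addr0; apply; lra.
have l2 : ln s^-1 <= s^-1 - 1.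
  have := @le_ln1Dx R (s^-1 - 1); rewrite addrCA subrr addr0; apply.
  have : 0 < s^-1 by rewrite invr_gt0.
  lra.
have l3 : s * ln s^-1 <= s * (s^-1 - 1) by rewrite ler_pM2l.
have l5 : s * (s^-1 - 1) = 1 - s by field; rewrite gt_eqF.
rewrite l5 in l3.
have l4 : s * ln s <= s * (s - 1) by rewrite ler_pM2l.
rewrite ler_norml; apply/andP; split; last by rewrite /eta; lra.
rewrite etaE//; have : s * (s - 1) <= 2 by nra.
lra.
Qed.

(** Write s = r t with r in [0, 2] and use eta (r t) = r eta t + t eta r. This supplies the
    integrable majorant for densities that are at most twice a given one. *)
Lemma eta_dominated s t : 0 <= s <= 2 * t -> `|eta s| <= 2 * `|eta t| + 2 * t.
Proof.
move=> /andP[s0 st]; have t0 : 0 <= t by lra.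
move: t0; rewrite le_eqVlt => /predU1P[t0|t0].
  have -> : s = 0 by move: st; rewrite -t0; lra.
  by rewrite -t0 eta0 normr0; lra.
have : 0 <= s / t <= 2 by rewrite divr_ge0 ?(ltW t0)//= ler_pdivrMr.
rewrite -[s in eta s](@divfK _ t) ?gt_eqF//.
move: (s / t) => r /andP[r0 r2]; rewrite etaM ?(ltW t0)//.
apply: (le_trans (ler_normD _ _)); rewrite !(normrM _ (eta _)) (ger0_norm r0) (gtr0_norm t0).
apply: lerD; first exact: ler_wpM2r.
by rewrite mulrC ler_wpM2r ?(ltW t0)// eta_le2// r0.
Qed.

(** With c = k^d, summing over a probability law makes the last term equal to d ln k; see
    [shannon_entropy_scaled]. *)
Lemma eta_scale c s : 0 < c -> 0 <= s -> c^-1 * eta (c * s) = eta s - s * ln c.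
Proof.
move=> c0 s0; rewrite etaM ?(ltW c0)// (etaE c0).
by field; rewrite gt_eqF.
Qed.

(* [eta] is within [e] of [t |-> - t ln (t + e)], which is Lipschitz on [[0, M]]. *)
Lemma eta_modulus M e : 0 < M -> 0 < e -> exists2 C : R, 0 <= C &
  forall s t, 0 <= s <= M -> 0 <= t <= M -> `|eta s - eta t| <= e + C * `|s - t|.
Proof.
move=> M0 e0; pose r := e / 2; have r0 : 0 < r by rewrite divr_gt0.
pose f t := - (t * ln (t + r)).
have feta t : 0 <= t -> `|eta t - f t| <= r.
  rewrite le_eqVlt => /predU1P[<-|t0].
    by rewrite eta0 /f mul0r oppr0 subr0 normr0 ltW.
  rewrite etaE// /f opprK addrC.
  have -> : t * ln (t + r) - t * ln t = t * ln (1 + r / t).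
    rewrite -mulrBr -ln_div ?posrE ?addr_gt0// mulrDl mulfV ?gt_eqF//.
  have rt : 0 < r / t by rewrite divr_gt0.
  rewrite ger0_norm; last by rewrite mulr_ge0 ?(ltW t0)// ln_ge0// lerDl ltW.
  rewrite -[leRHS](@divfK _ t) ?gt_eqF// mulrC ler_wpM2r ?(ltW t0)//.
  by apply: le_ln1Dx; lra.
pose A := `|ln r| + `|ln (M + r)|.
have lnA t : 0 <= t <= M -> `|ln (t + r)| <= A.
  move=> /andP[t0 tM].
  have h1 : ln r <= ln (t + r) by rewrite ler_ln ?posrE; lra.
  have h2 : ln (t + r) <= ln (M + r) by rewrite ler_ln ?posrE; lra.
  rewrite ler_norml /A; have := ler_norm (- ln r); have := ler_norm (ln (M + r)).
  rewrite normrN; have := normr_ge0 (ln r); have := normr_ge0 (ln (M + r)).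
  by move=> *; apply/andP; split; lra.
have flip s t : 0 <= s -> s <= t -> t <= M -> `|f s - f t| <= (A + 1) * `|s - t|.
  move=> s0 st tM.
  (* The first term costs [A * |s - t|]. The second is at most s (t - s) / (s + r), hence at most t
     - s, whence the constant [A + 1]. *)
  have -> : f s - f t = (t - s) * ln (t + r) + s * (ln (t + r) - ln (s + r)).
    by rewrite /f; ring.
  apply: (le_trans (ler_normD _ _)); rewrite !normrM (distrC s t) [(A + 1) * _]mulrC mulrDr mulr1.
  apply: lerD; first by rewrite ler_wpM2l// lnA//; apply/andP; split; lra.
  rewrite -ln_div ?posrE; try lra.
  have -> : (t + r) / (s + r) = 1 + (t - s) / (s + r) by field; lra.
  have h0 : 0 <= (t - s) / (s + r) by rewrite divr_ge0; lra.
  rewrite (ger0_norm s0) ger0_norm; last by rewrite ln_ge0// lerDl.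
  apply: (@le_trans _ _ (s * ((t - s) / (s + r)))).
    by rewrite ler_wpM2l// le_ln1Dx//; lra.
  rewrite ger0_norm ?subr_ge0// mulrA ler_pdivrMr; last lra.
  by rewrite mulrC ler_wpM2l; lra.
exists (A + 1); first by rewrite addr_ge0// /A addr_ge0.
move=> s t /andP[s0 sM] /andP[t0 tM].
have -> : eta s - eta t = (eta s - f s) - (eta t - f t) + (f s - f t) by ring.
apply: (le_trans (ler_normD _ _)); apply: lerD.
  apply: (le_trans (ler_normB _ _)); have := feta s s0; have := feta t t0; rewrite /r; lra.
have [st|/ltW ts] := leP s t; first exact: flip.
by rewrite distrC (distrC s t) flip.
Qed.

End eta.

Section boxseq.
Context {d : nat}.
Implicit Types (a : int) (L : nat) (z w : 'rV[int]_d).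

(** Serves both as a window of shifts and as the index list of the grid cells in a cube. *)
Definition boxseq a L : seq 'rV[int]_d :=
  [seq \row_l ((u l : nat)%:Z + a) | u : {ffun 'I_d -> 'I_L}].

Lemma size_boxseq a L : size (boxseq a L) = (L ^ d)%N.
Proof. by rewrite /boxseq size_map -cardE card_ffun !card_ord. Qed.

Lemma uniq_boxseq a L : uniq (boxseq a L).
Proof.
rewrite map_inj_uniq ?enum_uniq// => u v /rowP uv; apply/ffunP => l.
by have := uv l; rewrite !mxE => /addIr [] /val_inj.
Qed.

Lemma mem_boxseq a L z : (z \in boxseq a L) = [forall l, a <= z 0 l < a + L%:Z].
Proof.
apply/mapP/forallP => [[u _ ->] l|zb].
  by rewrite mxE -[X in X <= _]add0r lerD2r addrC ltrD2l ltz_nat ltn_ord.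
have h l : (absz (z 0 l - a)%R < L)%N by have := zb l; lia.
exists [ffun l => Ordinal (h l)]; first by rewrite mem_enum.
by apply/rowP => l; rewrite mxE ffunE /=; have := zb l; lia.
Qed.

End boxseq.

Section counting.
Context {T : eqType}.
Implicit Types (s : seq T) (D : pred T).

Lemma uniq_count_le D s1 s2 : uniq s1 -> {subset s1 <= s2} ->
  (count D s1 <= count D s2)%N.
Proof.
move=> us1 s12; rewrite -!size_filter; apply: uniq_leq_size.
  exact: filter_uniq.
by move=> x; rewrite !mem_filter => /andP[-> /s12].
Qed.

Lemma uniq_count_diff D s1 s2 : uniq s1 -> {subset s1 <= s2} ->
  (count D s2 <= count D s1 + (size s2 - size s1))%N.
Proof.
move=> us1 s12; have := uniq_count_le (predC D) us1 s12.
have := count_predC D s1; have := count_predC D s2.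
have := uniq_leq_size us1 s12; lia.
Qed.

Lemma uniq_ler_sum {R : numDomainType} (F : T -> R) s1 s2 :
  (forall x, 0 <= F x) -> uniq s1 -> uniq s2 -> {subset s1 <= s2} ->
  \sum_(x <- s1) F x <= \sum_(x <- s2) F x.
Proof.
move=> F0 us1 us2 s12; rewrite (bigID (mem s1))/= [leRHS](bigID (mem s1))/=.
rewrite [X in _ + X <= _]big1_seq; last by move=> i /andP[/negP].
rewrite addr0 -[leLHS]addr0 lerD//; last exact: sumr_ge0.
rewrite -!(big_filter _ (mem s1)) le_eqVlt; apply/orP; left; apply/eqP.
apply: perm_big; apply: uniq_perm; rewrite ?filter_uniq// => x.
rewrite !mem_filter; change (mem s1 x) with (x \in s1).
by have [/s12 ->|//] := boolP (x \in s1).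
Qed.

End counting.

(** The windows translated to [z] and to [w] both contain the core z + [C, tau - C)^d, so only the
    points of a window outside this core can be counted differently. *)
Lemma count_window {d} (D : pred 'rV[int]_d) (z w : 'rV[int]_d) (C tau : nat) :
  (forall l, `|z 0 l - w 0 l| <= C%:Z) -> (2 * C <= tau)%N ->
  (count (fun t => D (z + t)%R) (boxseq 0%R tau) <=
   count (fun t => D (w + t)%R) (boxseq 0%R tau) + (tau ^ d - (tau - 2 * C) ^ d))%N.
Proof.
move=> zw Ct.
have cm (v : 'rV[int]_d) : count (fun t => D (v + t)) (boxseq 0 tau) = count D [seq v + t | t <- boxseq 0 tau].
  by rewrite [RHS]count_map.
rewrite !cm; pose s := [seq z + t | t <- boxseq C%:Z (tau - 2 * C)%N].
have us : uniq s by rewrite map_inj_uniq ?uniq_boxseq//; exact: addrI.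
have ss (v : 'rV[int]_d) : (forall l, `|z 0 l - v 0 l| <= C%:Z) -> {subset s <= [seq v + t | t <- boxseq 0 tau]}.
  move=> zv _ /mapP[t + ->]; rewrite mem_boxseq => /forallP tb.
  apply/mapP; exists (z + t - v); last by rewrite [RHS]addrC subrK.
  rewrite mem_boxseq; apply/forallP => l; rewrite !mxE.
  have := tb l; have := zv l; move: (z 0 l) (t 0 l) (v 0 l) => x y u; lia.
have := uniq_count_diff D us (ss z (fun l => _)).
have := uniq_count_le D us (ss w zw).
have sz (v : 'rV[int]_d) a L : size [seq v + t | t <- boxseq a L] = (L ^ d)%N.
  by rewrite size_map size_boxseq.
rewrite !sz => h1 h2.
apply: leq_trans (h2 _) _; first by move=> l; rewrite subrr normr0.
by rewrite leq_add2r.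
Qed.

(** Being an integer combination of the [a j] holds for 0 and for each absolute value, and passes to
    gcds by the binary Bezout identity. *)
Lemma big_gcdn_bezout (m : nat) (a : 'I_m -> int) :
  exists b : 'I_m -> int, \sum_j a j * b j = (\big[gcdn/0%N]_j `|a j|%N)%:Z.
Proof.
apply: (big_ind (fun g : nat => exists b : 'I_m -> int, \sum_j a j * b j = g%:Z)).
- by exists (fun=> 0); rewrite big1// => j _; rewrite mulr0.
- move=> x y [b hb] [c hc]; have [u [v uv]] := Bezoutz x%:Z y%:Z.
  exists (fun j => u * b j + v * c j).
  transitivity (u * x%:Z + v * y%:Z); last by rewrite uv.
  rewrite -hb -hc !mulr_sumr -big_split/=; apply: eq_bigr => j _; ring.
- move=> i _; exists (fun j => if j == i then Num.sg (a i) else 0).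
  rewrite (bigD1 i)//= eqxx big1 => [|j /negPf ->]; last by rewrite mulr0.
  by rewrite addr0 mulrC -normrEsg abszE.
Qed.

(* Hybrid argument: [q] and [p] are interpolated by using [q] on the first [k] factors. *)
Lemma prod_dist_le {R : realDomainType} {F : finType} (m : nat) (p q : 'I_m -> F -> R) :
  (forall j v, 0 <= p j v) -> (forall j v, 0 <= q j v) ->
  (forall j, \sum_v p j v <= 1) -> (forall j, \sum_v q j v <= 1) ->
  \sum_(u : {ffun 'I_m -> F}) `|\prod_j p j (u j) - \prod_j q j (u j)| <=
  \sum_j \sum_v `|p j v - q j v|.
Proof.
move=> p0 q0 p1 q1.
pose h (k : nat) (j : 'I_m) v := if (j < k)%N then q j v else p j v.
(* Consecutive hybrids differ in the factor [k] alone, so the absolute value of their difference is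
   again a product, with factors [G k]. *)
pose G (k j : 'I_m) v := if (j < k)%N then q j v else
  if j == k then `|p j v - q j v| else p j v.
have hG (u : {ffun 'I_m -> F}) (k : 'I_m) :
    `|\prod_j h k j (u j) - \prod_j h k.+1 j (u j)| = \prod_j G k j (u j).
  rewrite (bigD1 k)//= [X in _ - X](bigD1 k)//= [RHS](bigD1 k)//=.
  have -> : h k k (u k) = p k (u k) by rewrite /h ltnn.
  have -> : h k.+1 k (u k) = q k (u k) by rewrite /h ltnS leqnn.
  rewrite /G ltnn eqxx.
  rewrite [X in _ - _ * X](_ : _ = \prod_(i < m | i != k) h k i (u i)); last first.
    apply: eq_bigr => i; rewrite -val_eqE/= => ik.
    by rewrite /h ltnS leq_eqVlt (negPf ik).
  rewrite -mulrBl normrM; congr (_ * _).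
  rewrite ger0_norm; last by apply: prodr_ge0 => i _; rewrite /h; case: ifP.
  by apply: eq_bigr => i ik; rewrite /h (negPf ik).
have tele (u : {ffun 'I_m -> F}) :
    `|\prod_j p j (u j) - \prod_j q j (u j)| <= \sum_k \prod_j G k j (u j).
  rewrite -(eq_bigr _ (fun k _ => hG u k)).
  apply: le_trans (ler_norm_sum _ _ _).
  pose A k := \prod_j h k j (u j).
  rewrite -(big_mkord xpredT (fun k => A k - A k.+1)).
  have -> : \sum_(0 <= k < m) (A k - A k.+1) = A 0%N - A m.
    rewrite -[LHS]opprK -sumrN (eq_bigr (fun k => A k.+1 - A k)) => [|k _]; last by rewrite opprB.
    by rewrite telescope_sumr// opprB.
  rewrite /A.
  rewrite [X in _ <= `|X - _|](_ : _ = \prod_j p j (u j))//.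
  rewrite [X in _ <= `|_ - X|](_ : _ = \prod_j q j (u j))//.
  by apply: eq_bigr => j _; rewrite /h ltn_ord.
apply: le_trans (ler_sum _ (fun u _ => tele u)) _.
rewrite exchange_big/=; apply: ler_sum => k _.
(* The sum of products is a product of sums: the factor [k] gives the L1 distance, every other one
   is at most 1. *)
rewrite -(bigA_distr_bigA (G k)) (bigD1 k)//= {1}/G ltnn eqxx.
apply: ler_piMr; first exact: sumr_ge0.
apply: prodr_ile1 => j jk; rewrite /G (negPf jk).
by case: (j < k)%N; apply/andP; split; rewrite ?q1 ?p1 ?sumr_ge0.
Qed.

Lemma bernoulli_le {R : realDomainType} (d : nat) (r : R) : 0 <= r <= 1 ->
  1 - d%:R * r <= (1 - r) ^+ d.
Proof.
move=> /andP[r0 r1]; elim: d => [|d IH]; first by rewrite mul0r subr0 expr0.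
rewrite exprS; apply: (@le_trans _ _ ((1 - r) * (1 - d%:R * r))); last first.
  by rewrite ler_wpM2l// subr_ge0.
rewrite -natr1; have : 0 <= d%:R * (r * r) by rewrite !mulr_ge0.
lra.
Qed.

(** * Lipschitz approximation in L1 *)

Section integral_prelim.
Context {dT : measure_display} {T : measurableType dT} {R : realType}.
Variable mu : {measure set T -> \bar R}.
Implicit Types (D : set T) (f g h : T -> R).

Lemma ge0_integral_le_add D f g h : measurable D ->
  measurable_fun D f -> measurable_fun D g -> measurable_fun D h ->
  (forall x, 0 <= f x) -> (forall x, 0 <= g x) -> (forall x, 0 <= h x) ->
  (forall x, D x -> f x <= g x + h x) ->
  (\int[mu]_(x in D) (f x)%:E <=
   \int[mu]_(x in D) (g x)%:E + \int[mu]_(x in D) (h x)%:E)%E.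
Proof.
move=> mD mf mg mh f0 g0 h0 fgh.
rewrite -ge0_integralD//; last 4 first.
- by move=> x _; rewrite lee_fin.
- exact/measurable_EFinP.
- by move=> x _; rewrite lee_fin.
- exact/measurable_EFinP.
apply: ge0_le_integral => //.
- by move=> x _; rewrite lee_fin.
- exact/measurable_EFinP.
- by apply: emeasurable_funD; exact/measurable_EFinP.
Qed.

Lemma measure_decr_small (K : set T) (E : (set T)^nat) (e : R) :
  measurable K -> (mu K < +oo)%E -> (forall n, measurable (E n)) ->
  (forall n m, (n <= m)%N -> E m `<=` E n) -> \bigcap_n E n = set0 -> 0 < e ->
  exists n, (mu (K `&` E n) <= e%:E)%E.
Proof.
move=> mK Koo mE decE E0 e0.
have mKE n : measurable (K `&` E n) by exact: measurableI.
have cap : \bigcap_n (K `&` E n) = set0.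
  rewrite -subset0 => x Hx; rewrite -E0 => n _.
  by have [] := Hx n I.
have : (mu \o (fun n => K `&` E n)) x @[x --> \oo] --> mu (\bigcap_n (K `&` E n)).
  apply: nonincreasing_cvg_mu => //.
  - by apply: le_lt_trans Koo; apply: le_measure; rewrite ?inE//; exact: subIsetl.
  - by rewrite cap.
  - by move=> n m nm; apply/subsetPset; apply: setIS; exact: decE.
rewrite cap measure0 => /fine_cvgP[[n0 _ fin] /cvgrPdist_le/(_ e e0)[n1 _ small]].
pose n := maxn n0 n1; exists n.
have := small n (leq_maxr _ _); rewrite /= sub0r normrN => h.
have := fin n (leq_maxl _ _) => /= fi.
by rewrite -(fineK fi) lee_fin; apply: le_trans h; rewrite ler_norm.
Qed.

End integral_prelim.

Section lipschitz.
Context {R : realType} {d : nat}.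
Notation V := 'rV[R]_d.
Notation B := (BorelRd R d).

(** Lipschitz for the sup distance, phrased with any coordinatewise bound [e], since cells and
    integer shifts provide bounds of exactly this kind. *)
Definition is_lip (L : R) (phi : V -> R) := forall (x y : V) e, 0 <= e ->
  (forall l, `|x 0 l - y 0 l| <= e) -> `|phi x - phi y| <= L * e.

Lemma is_lip_continuous L phi : is_lip L phi -> continuous phi.
Proof.
move=> lip x s /= /(nbhs_ballP (phi x))[e /= e0 es].
have L0 : 0 < `|L| + 1 by rewrite ltr_wpDl.
have de : 0 < e / (`|L| + 1) by rewrite divr_gt0.
apply/nbhs_ballP; exists (e / (`|L| + 1)) => // y [_ xy].
apply: es; rewrite /ball /=.
have : `|phi x - phi y| <= L * (e / (`|L| + 1)).
  apply: lip; first exact: ltW.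
  by move=> l; apply: ltW; exact: (xy 0 l).
move=> /le_lt_trans; apply.
rewrite mulrA mulrAC gtr_pMl// ltr_pdivrMr// mul1r.
by rewrite (le_lt_trans (ler_norm _))// ltrDl.
Qed.

Lemma continuous_measurable_Rd (f : V -> R) : continuous f ->
  measurable_fun [set: B] (f : B -> R).
Proof.
move=> cf; apply: measurability; first exact: RGenOpens.measurableE.
move=> _ [_ [a [b ->]] <-]; rewrite setTI; apply: sub_sigma_algebra.
by move/continuousP : cf; apply; exact: interval_open.
Qed.

Lemma is_lip_measurable L phi : is_lip L phi -> measurable_fun [set: B] (phi : B -> R).
Proof. by move=> /is_lip_continuous; exact: continuous_measurable_Rd. Qed.

Definition set_dist (A : set V) (x : V) : R :=
  inf [set r | 0 <= r /\ exists2 a : V, A a & forall l, `|x 0 l - a 0 l| <= r].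

Let dist_has_inf (A : set V) (x : V) : A !=set0 ->
  has_inf [set r | 0 <= r /\ exists2 a : V, A a & forall l, `|x 0 l - a 0 l| <= r].
Proof.
move=> [a Aa]; split; last by exists 0 => r [].
exists (\sum_l `|x 0 l - a 0 l|); split; first exact: sumr_ge0.
exists a => // l; rewrite (bigD1 l)//= lerDl; exact: sumr_ge0.
Qed.

Lemma set_dist_ge0 A x : A !=set0 -> 0 <= set_dist A x.
Proof. by move=> A0; apply: lb_le_inf; [exact: (dist_has_inf _ A0).1|move=> r []]. Qed.

Lemma set_dist_mem (A : set V) x : A x -> set_dist A x = 0.
Proof.
move=> Ax; have A0 : A !=set0 by exists x.
apply/eqP; rewrite eq_le set_dist_ge0// andbT; apply: ge_inf; first exact: (dist_has_inf _ A0).2.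
by split=> //; exists x => // l; rewrite subrr normr0.
Qed.

Lemma set_dist_lip A : A !=set0 -> is_lip 1 (set_dist A).
Proof.
move=> A0; suff H (x y : V) (e : R) : 0 <= e -> (forall l, `|x 0 l - y 0 l| <= e) ->
    set_dist A x <= set_dist A y + e.
  move=> x y e e0 xy; rewrite mul1r ler_norml; apply/andP; split.
    by rewrite lerBrDl lerBlDr; apply: H => // l; rewrite distrC.
  by rewrite lerBlDl; exact: H.
move=> e0 xy; rewrite -lerBlDr; apply: lb_le_inf; first exact: (dist_has_inf _ A0).1.
move=> r [r0 [a Aa ya]]; rewrite lerBlDr; apply: ge_inf; first exact: (dist_has_inf _ A0).2.
split; first exact: addr_ge0.
exists a => // l; rewrite -(subrKA (y 0 l)) (le_trans (ler_normD _ _))// addrC lerD//.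
Qed.

Lemma set_dist_gt0 (A : set V) x : A !=set0 -> open (~` A) -> ~ A x -> 0 < set_dist A x.
Proof.
move=> A0 oA nAx; have /nbhs_ballP[e /= e0 xe] : nbhs x (~` A) by exact: open_nbhs_nbhs.
apply: (lt_le_trans e0); apply: lb_le_inf; first exact: (dist_has_inf _ A0).1.
move=> r [r0 [a Aa xa]]; rewrite leNgt; apply/negP => re.
apply: (xe a _ Aa); split => // i l; rewrite (ord1 i).
by apply: le_lt_trans re; exact: xa.
Qed.

End lipschitz.

Section lipschitz_approx.
Context {R : realType} {d : nat}.
Notation V := 'rV[R]_d.
Notation B := (BorelRd R d).
Variables (mu : {measure set B -> \bar R}) (K : set B).
Hypotheses (mK : measurable K) (Koo : (mu K < +oo)%E).

(** The closure of the Lipschitz functions in L1 of [K]. The lemmas below carry membership from open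
    sets to Borel sets, then to simple functions and to all integrable ones. *)
Definition lip_approx (f : V -> R) := measurable_fun [set: B] (f : B -> R) /\
  forall e : R, 0 < e -> exists phi L, is_lip L phi /\
    (\int[mu]_(x in K) `|f x - phi x|%:E <= e%:E)%E.

Let mabs (f g : V -> R) : measurable_fun [set: B] (f : B -> R) ->
  measurable_fun [set: B] (g : B -> R) ->
  measurable_fun K ((fun x => `|f x - g x|) : B -> R).
Proof.
move=> mf mg; apply: measurable_funTS; apply: measurableT_comp => //.
exact: measurable_funB.
Qed.

Lemma lip_approx_lim f : measurable_fun [set: B] (f : B -> R) ->
  (forall e : R, 0 < e -> exists2 g, lip_approx g &
    (\int[mu]_(x in K) `|f x - g x|%:E <= e%:E)%E) -> lip_approx f.
Proof.
move=> mf H; split=> // e e0; have e2 : 0 < e / 2 by rewrite divr_gt0.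
have [g [mg ag] fg] := H _ e2; have [phi [L [lphi gphi]]] := ag _ e2.
exists phi, L; split => //.
rewrite [e]splitr EFinD; apply: le_trans (leeD fg gphi).
apply: ge0_integral_le_add => //; try (by apply: mabs => //; exact: is_lip_measurable lphi).
by move=> x _; rewrite -(subrKA (g x)) ler_normD.
Qed.

Lemma lip_approx_cst c : lip_approx (fun=> c).
Proof.
split => // e e0; exists (fun=> c), 0; split => //.
  by move=> x y r _ _; rewrite subrr normr0 mul0r.
under eq_integral do rewrite subrr normr0.
by rewrite integral0 lee_fin ltW.
Qed.

Lemma lip_approx_max f g : lip_approx f -> lip_approx g ->
  lip_approx (fun x => Num.max (f x) (g x)).
Proof.
move=> [mf af] [mg ag]; split; first exact: measurable_maxr.
move=> e e0; have e2 : 0 < e / 2 by rewrite divr_gt0.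
have [phi [L [lphi fphi]]] := af _ e2.
have [psi [L' [lpsi gpsi]]] := ag _ e2.
have maxd (s t u v : R) : `|Num.max s t - Num.max u v| <= Num.max `|s - u| `|t - v|.
  rewrite !maxEle; do 3 case: ifPn; rewrite -?ltNge => *; move: (normr_ge0 (s - u)) (normr_ge0 (t - v));
  rewrite ler_norml;
  have := ler_norm (s - u); have := ler_norm (t - v);
  have := ler_norm (u - s); have := ler_norm (v - t); rewrite (distrC u) (distrC v) => *; apply/andP; split; lra.
have lm : is_lip (Num.max L L') (fun x => Num.max (phi x) (psi x)).
  move=> x y r r0 xy; apply: (le_trans (maxd _ _ _ _)).
  rewrite ge_max; apply/andP; split.
    by apply: (le_trans (lphi _ _ _ r0 xy)); rewrite ler_wpM2r// le_max lexx.
  by apply: (le_trans (lpsi _ _ _ r0 xy)); rewrite ler_wpM2r// le_max lexx orbT.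
exists (fun x => Num.max (phi x) (psi x)), (Num.max L L'); split => //.
rewrite [e]splitr EFinD; apply: le_trans (leeD fphi gpsi).
apply: ge0_integral_le_add => //.
- by apply: mabs; [exact: measurable_maxr|exact: is_lip_measurable lm].
- by apply: mabs => //; exact: is_lip_measurable lphi.
- by apply: mabs => //; exact: is_lip_measurable lpsi.
- move=> x _; apply: (le_trans (maxd _ _ _ _)).
  by rewrite ge_max lerDl lerDr !normr_ge0.
Qed.

Lemma lip_approx_lin c f g : lip_approx f -> lip_approx g ->
  lip_approx (fun x => c * f x + g x).
Proof.
move=> [mf af] [mg ag].
have mfg : measurable_fun [set: B] ((fun x => c * f x + g x) : B -> R).
  by apply: measurable_funD => //; exact: measurable_funM.
split => // e e0; have e2 : 0 < e / 2 by rewrite divr_gt0.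
have c0 : 0 < `|c| + 1 by rewrite ltr_wpDl.
have e3 : 0 < e / 2 / (`|c| + 1) by rewrite divr_gt0.
have [phi [L [lphi fphi]]] := af _ e3.
have [psi [L' [lpsi gpsi]]] := ag _ e2.
have lm : is_lip (`|c| * L + L') (fun x => c * phi x + psi x).
  move=> x y r r0 xy; rewrite opprD addrACA -mulrBr (le_trans (ler_normD _ _))//.
  by rewrite mulrDl lerD ?lpsi// normrM -mulrA ler_wpM2l// lphi.
exists (fun x => c * phi x + psi x), (`|c| * L + L'); split => //.
have h : (\int[mu]_(x in K) (`|c| * `|f x - phi x|)%:E <= (e / 2)%:E)%E.
  under eq_integral do rewrite EFinM.
  rewrite ge0_integralZl_EFin//; last first.
    by apply/measurable_EFinP; apply: mabs => //; exact: is_lip_measurable lphi.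
  apply: (@le_trans _ _ (`|c|%:E * (e / 2 / (`|c| + 1))%:E)%E).
    by apply: lee_wpmul2l fphi; rewrite lee_fin.
  rewrite -EFinM lee_fin mulrCA ger_pMr// ler_pdivrMr// mul1r.
  by rewrite lerDl.
rewrite [e]splitr EFinD; apply: le_trans (leeD h gpsi).
have mphi := is_lip_measurable lphi; have mpsi := is_lip_measurable lpsi.
apply: ge0_integral_le_add => //.
- by apply: mabs => //; exact: is_lip_measurable lm.
- by apply: measurable_funM => //; apply: mabs.
- exact: mabs.
- move=> x _; rewrite opprD addrACA -mulrBr (le_trans (ler_normD _ _))//.
  by rewrite normrM.
Qed.

(** The approximants are min(1, (n+1) dist(x, complement of O)). They differ from the indicator only
    at points of [O] closer than 1/(n+1) to the complement, and these sets decrease to the empty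
    set. The whole space is treated apart, having no complement to measure distances to. *)
Lemma lip_approx_open (O : set V) : open O -> lip_approx \1_O.
Proof.
move=> oO; have mO : measurable (O : set B) by exact: sub_sigma_algebra.
have m1 : measurable_fun [set: B] (\1_O : B -> R) by exact: measurable_indic.
have [A0|] := pselect ((~` O) !=set0); last first.
  move=> /set0P/negP; rewrite negbK => /eqP/(congr1 setC); rewrite setCK setC0 => ->.
  rewrite (_ : \1_setT = fun=> 1); last by apply/funext => x; rewrite indicT.
  exact: lip_approx_cst.
pose dO := set_dist (~` O); have dlip := set_dist_lip A0.
have mdO : measurable_fun [set: B] (dO : B -> R) by exact: is_lip_measurable dlip.
pose E n : set B := O `&` [set x | dO x < n.+1%:R^-1].
have mE n : measurable (E n).
  apply: measurableI => //; rewrite -[X in measurable X]setTI.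
  rewrite (_ : [set x | _] = dO @^-1` `]-oo, n.+1%:R^-1[); first exact: mdO.
  by apply/seteqP; split => x /=; rewrite in_itv.
split => // e e0.
have [||n En] := measure_decr_small mK Koo mE _ _ e0.
- move=> n m nm x [Ox /= h]; split => //; apply: lt_le_trans h _.
  by rewrite lef_pV2 ?posrE// ler_nat.
- rewrite -subset0 => x Hx; have [Ox _] := Hx 0%N I.
  have d0 : 0 < dO x by apply: set_dist_gt0 => //; rewrite ?setCK//; apply.
  have [n nd] : exists n, n.+1%:R^-1 < dO x.
    exists (Num.truncn (dO x)^-1); rewrite invf_plt ?posrE//.
    exact: truncnS_gt.
  by have [_ /= /lt_trans/(_ nd)] := Hx n I; rewrite ltxx.
pose phi x := Num.min 1 (n.+1%:R * dO x).
have d0 x : 0 <= dO x by exact: set_dist_ge0.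
have lphi : is_lip n.+1%:R phi.
  move=> x y r r0 xy; have := dlip x y r r0 xy; rewrite mul1r -/dO => h.
  have h2 : `|n.+1%:R * dO x - n.+1%:R * dO y| <= n.+1%:R * r.
    by rewrite -mulrBr normrM ger0_norm// ler_wpM2l.
  apply: le_trans h2; rewrite /phi !minEle.
  do 2 case: ifPn; rewrite -?ltNge => *; move: (ler_norm (n.+1%:R * dO x - n.+1%:R * dO y)) (ler_norm (n.+1%:R * dO y - n.+1%:R * dO x));
    rewrite (distrC (n.+1%:R * dO y)) ler_norml => *; apply/andP; split; lra.
exists phi, n.+1%:R; split => //.
apply: le_trans En; rewrite setIC -integral_indic//.
apply: ge0_le_integral => //.
- by apply/measurable_EFinP; apply: mabs => //; exact: is_lip_measurable lphi.
- by apply/measurable_EFinP; apply: measurable_indic.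
- move=> x _; rewrite lee_fin !indicE.
  have [/set_mem Ox|/negP nOx] := boolP (x \in O).
    have [xE|/negP xE] := boolP (x \in E n).
      rewrite ger0_norm; last by rewrite subr_ge0 /phi ge_min lexx.
      by rewrite lerBlDr lerDl /phi le_min ler01 mulr_ge0.
    have : n.+1%:R^-1 <= dO x.
      by rewrite leNgt; apply/negP => h; apply: xE; rewrite inE.
    rewrite -[n.+1%:R^-1]mul1r ler_pdivrMr// mulrC => h.
    by rewrite /phi (min_idPl h) subrr normr0.
  rewrite /phi /dO set_dist_mem; last by move=> /mem_set.
  by rewrite mulr0 (min_idPr _)// subrr normr0 ler0n.
Qed.

(** The Borel sets with approximable indicator form a sigma-algebra containing the open sets.
    Complements are affine images; a countable union is the limit of finite unions, whose indicators
    are maxima, because the missing part decreases to the empty set inside [K]. *)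
Lemma lip_approx_indic (A : set V) : measurable (A : set B) -> lip_approx \1_A.
Proof.
pose G := [set A : set V | measurable (A : set B) /\ lip_approx \1_A].
move=> mA; suff : G A by case.
apply: (@smallest_sub _ _ (@open V) G _ _ _ mA); last first.
  by move=> O oO; split; [exact: sub_sigma_algebra|exact: lip_approx_open].
split.
- split => //; rewrite (_ : \1_set0 = fun=> 0); first exact: lip_approx_cst.
  by apply/funext => x; rewrite indic0.
- move=> C [mC aC]; rewrite setTD; split; first exact: measurableC.
  rewrite (_ : \1_(~` C) = fun x => -1 * \1_C x + 1).
    by apply: lip_approx_lin => //; exact: lip_approx_cst.
  by apply/funext => x; rewrite !indicE in_setC; case: (x \in C); rewrite /=; lra.
- move=> F GF; have mF n : measurable (F n : set B) by have [] := GF n.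
  have mU : measurable (\bigcup_n F n : set B) by exact: bigcupT_measurable.
  split => //; pose U n : set V := \big[setU/set0]_(i < n) F i.
  have mUn n : measurable (U n : set B) by exact: bigsetU_measurable.
  have aU n : lip_approx \1_(U n).
    elim: n => [|n IH].
      rewrite /U big_ord0 (_ : \1_set0 = fun=> 0); first exact: lip_approx_cst.
      by apply/funext => x; rewrite indic0.
    rewrite /U big_ord_recr/= -/(U n).
    rewrite (_ : \1_(_ `|` _) = fun x => Num.max (\1_(U n) x) (\1_(F n) x)).
      by apply: lip_approx_max => //; have [] := GF n.
    apply/funext => x; rewrite !indicE in_setU.
    by case: (x \in U n); case: (x \in F n); rewrite /= maxEle ?lexx ?ler01 ?ler10.
  apply: lip_approx_lim; first exact: measurable_indic.
  move=> e e0; pose E n : set B := \bigcup_i F i `\` U n.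
  have mE n : measurable (E n) by exact: measurableD.
  have subU n m : (n <= m)%N -> U n `<=` U m.
    by move=> nm; exact: subset_bigsetU.
  have [||n En] := measure_decr_small mK Koo mE _ _ e0.
  + by move=> n m nm; apply: setDS; exact: subU.
  + rewrite -subset0 => x Hx; have [[i _ Fi] _] := Hx 0%N I.
    have [_] := Hx i.+1 I; apply.
    by rewrite /U big_ord_recr/=; right.
  exists \1_(U n) => //; apply: le_trans En; rewrite setIC -integral_indic//.
  apply: ge0_le_integral => //.
  + by apply/measurable_EFinP; apply: mabs; exact: measurable_indic.
  + by apply/measurable_EFinP; exact: measurable_indic.
  + move=> x _; rewrite lee_fin !indicE /E in_setD.
    have UU : x \in U n -> x \in \bigcup_i F i.
      by rewrite !inE; apply: bigsetU_bigcup.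
    case: (x \in U n) UU => [-> //|_]; first by rewrite /= subrr normr0.
    by case: (x \in \bigcup_i F i); rewrite /= ?subrr ?normr0 ?subr0 ?normr1.
Qed.

Lemma lip_approx_fsum (S : eqType) (r : seq S) (c : S -> R) (g : S -> V -> R) :
  (forall y, lip_approx (g y)) -> lip_approx (fun x => \sum_(y <- r) c y * g y x).
Proof.
move=> ag; elim: r => [|y r IH].
  by under eq_fun do rewrite big_nil; exact: lip_approx_cst.
by under eq_fun do rewrite big_cons; exact: lip_approx_lin.
Qed.

Import HBSimple.

Lemma integrable_lip_approx (f : V -> R) : measurable_fun [set: B] (f : B -> R) ->
  mu.-integrable K (fun x : B => (f x)%:E) -> lip_approx f.
Proof.
move=> mf intf; apply: lip_approx_lim => // e e0.
have [g [gi _ gcvg]] := approximation_sfun_integrable mK intf.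
have ag n : lip_approx (g n).
  rewrite (_ : (g n : V -> R) = fun x => \sum_(y <- finmap.enum_fset (fset_set (range (g n)))) y * \1_(g n @^-1` [set y]) x).
    by apply: lip_approx_fsum => y; apply: lip_approx_indic; exact: measurable_sfunP.
  by apply/funext => x; rewrite fimfunE fsbig_finite//; exact: fimfunP.
move/fine_cvgP : gcvg => [[n0 _ fin] /cvgrPdist_le/(_ e e0)[n1 _ small]].
pose n := maxn n0 n1; exists (g n) => //.
have := small n (leq_maxr _ _); rewrite /= sub0r normrN => h.
have := fin n (leq_maxl _ _) => /= fi.
rewrite (eq_integral (fun x : B => `|(f x)%:E - (g n x)%:E|%E)) => [|x _]; last by rewrite -EFinB.
by rewrite -(fineK fi) lee_fin; apply: le_trans h; rewrite ler_norm.
Qed.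

End lipschitz_approx.

(** * Grid cells *)

Section cells.
Context {R : realType} {d : nat}.
Notation V := 'rV[R]_d.
Notation B := (BorelRd R d).
Implicit Types (k N : nat) (z : 'rV[int]_d).

(** Both the index of the grid cell containing [x] and the quantization map: U_j is [cellv k]
    applied to X_j. *)
Definition cellv k (x : V) : 'rV[int]_d := \row_l Num.floor (k%:R * x 0 l).

Definition cell k z : set B := cellv k @^-1` [set z].

Definition corner k z : V := \row_l ((z 0 l)%:~R / k%:R).

Definition cube N : set B := [set x : V | forall l, - N%:R <= x 0 l <= N%:R].

Lemma measurable_coord (l : 'I_d) : measurable_fun [set: B] ((fun x : V => x 0 l) : B -> R).
Proof. apply: continuous_measurable_Rd; exact: coord_continuous. Qed.

Lemma measurable_coords (P : 'I_d -> set R) : (forall l, measurable (P l)) ->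
  measurable ([set x : V | forall l, P l (x 0 l)] : set B).
Proof.
move=> mP; rewrite (_ : [set x | _] = \bigcap_(l in [set: 'I_d]) ((fun x : V => x 0 l) @^-1` P l)); last first.
  by apply/seteqP; split => x /= Hx l; [move=> _|]; exact: Hx.
apply: fin_bigcap_measurable => // l _.
by rewrite -[X in measurable X]setTI; apply: measurable_coord.
Qed.

Lemma cellE k z : cell k z =
  [set x : V | forall l, (z 0 l)%:~R <= k%:R * x 0 l < (z 0 l + 1)%:~R].
Proof.
apply/seteqP; split => x; rewrite /cell /=.
  by move=> <- l; rewrite mxE floor_itv.
by move=> Hx; apply/rowP => l; rewrite mxE; exact: floor_def.
Qed.

Lemma measurable_cell k z : measurable (cell k z).
Proof.
rewrite cellE (_ : [set x | _] = [set x : V | forall l,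
    ((fun y : R => k%:R * y) @^-1` `[(z 0 l)%:~R, (z 0 l + 1)%:~R[) (x 0 l)]).
  apply: (measurable_coords (P := fun l => (fun y : R => k%:R * y) @^-1` `[(z 0 l)%:~R, (z 0 l + 1)%:~R[)) => l.
  rewrite -[X in measurable X]setTI.
  have mk : measurable_fun [set: R] (fun y : R => k%:R * y) by exact: mulrl_measurable.
  by apply: mk => //; exact: measurable_itv.
by apply/seteqP; split => x /= Hx l; have := Hx l; rewrite in_itv.
Qed.

Lemma measurable_cellv_preimage k (D : set 'rV[int]_d) : measurable (cellv k @^-1` D : set B).
Proof.
rewrite (_ : _ @^-1` _ = \bigcup_(z in D) cell k z); last first.
  by apply/seteqP; split => x; [exists (cellv k x)|move=> [z Dz cz]; rewrite /preimage/= (cz : cellv k x = z)].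
rewrite bigcup_mkcond; apply: countable_bigcupT_measurable => [|z].
  exact: countableP.
by case: ifP => _ //; exact: measurable_cell.
Qed.

Lemma trivIset_cell k D : trivIset D (cell k).
Proof. by move=> z w _ _ [x [cz cw]]; rewrite -(cz : cellv k x = z) -(cw : cellv k x = w). Qed.

Lemma cell_corner k z x l : (0 < k)%N -> cell k z x -> `|x 0 l - corner k z 0 l| <= k%:R^-1.
Proof.
move=> k0; rewrite cellE mxE => /(_ l) /andP[h1 h2].
have k1 : 0 < k%:R :> R by rewrite ltr0n.
have h3 : (z 0 l)%:~R / k%:R <= x 0 l by rewrite ler_pdivrMr// mulrC.
rewrite ger0_norm ?subr_ge0// lerBlDr -[in X in _ <= X + _](mul1r k%:R^-1) -mulrDl.
by rewrite ler_pdivlMr// mulrC ltW// (lt_le_trans h2)// intrD addrC.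
Qed.

Lemma measurable_cube N : measurable (cube N).
Proof.
rewrite /cube (_ : [set x | _] = [set x : V | forall l, `[- N%:R, N%:R]%classic (x 0 l)]).
  exact: (measurable_coords (P := fun=> `[- N%:R, N%:R]%classic)).
by apply/seteqP; split => x /= Hx l; have := Hx l; rewrite in_itv.
Qed.

Lemma cube_subset N M : (N <= M)%N -> cube N `<=` cube M.
Proof.
move=> NM x /= Hx l; have := Hx l; have : N%:R <= M%:R :> R by rewrite ler_nat.
by move=> ? /andP[*]; apply/andP; split; lra.
Qed.

(** These cells tile [-N, N)^d and miss the upper faces of the closed [cube N]; hence the
    requirement [N < N'] wherever cells have to cover a cube. *)
Definition cells k N := boxseq (d := d) (- (k * N)%N%:Z) (k * N).*2.

Lemma mem_cells k N z : (z \in cells k N) =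
  [forall l, - (k * N)%N%:Z <= z 0 l < (k * N)%N%:Z].
Proof. by rewrite mem_boxseq; apply: eq_forallb => l; congr (_ && (_ < _)); lia. Qed.

Lemma size_cells k N : size (cells k N) = ((k * N).*2 ^ d)%N.
Proof. exact: size_boxseq. Qed.

Lemma cells_sub_cube k N z : (0 < k)%N -> z \in cells k N -> cell k z `<=` cube N.
Proof.
move=> k0; rewrite mem_cells => /forallP zb x; rewrite cellE => xz l.
have k1 : 0 < k%:R :> R by rewrite ltr0n.
have /andP[h1 h2] := xz l; have /andP[z1 z2] := zb l.
have z1' : - (k%:R * N%:R) <= (z 0 l)%:~R :> R.
  by move: z1; rewrite -(ler_int R) mulrNz -natrM.
have z2' : (z 0 l + 1)%:~R <= k%:R * N%:R :> R.
  by rewrite -natrM -[X in _ <= X]/((Posz (k * N))%:~R) ler_int lezD1.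
apply/andP; split; rewrite -(ler_pM2l k1).
  by rewrite mulrN; lra.
by lra.
Qed.

Variable lam : {measure set B -> \bar R}.
Hypothesis lamE : lebesgue_Rd lam.

Lemma lam_cube N : lam (cube N) = (((N.*2)%:R ^+ d)%:E : \bar R).
Proof.
rewrite /cube; have := @lamE (const_mx (- N%:R)) (const_mx N%:R).
rewrite (_ : [set x : V | _] = [set x : V | forall l, - N%:R <= x 0 l <= N%:R]); last first.
  by apply/seteqP; split => x /= H l; have := H l; rewrite !mxE.
move=> ->; last by move=> l; rewrite !mxE; have : 0 <= N%:R :> R by []; lra.
under eq_bigr do rewrite !mxE opprK -natrD addnn.
by rewrite prodr_const card_ord.
Qed.

Lemma lam_cube_lty N : (lam (cube N) < +oo)%E.
Proof. by rewrite lam_cube ltry. Qed.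

(* The cell is squeezed between its closure and the closed boxes of side [(1 - r) / k]. *)
Lemma lam_cell k z : (0 < k)%N -> lam (cell k z) = ((k%:R^-1 ^+ d)%:E : \bar R).
Proof.
move=> k0; have k1 : 0 < k%:R :> R by rewrite ltr0n.
pose box (r : R) : set B := [set x : V | forall l, corner k z 0 l <= x 0 l <= corner k z 0 l + r].
have mbox r : measurable (box r).
  rewrite (_ : box r = [set x : V | forall l, `[corner k z 0 l, corner k z 0 l + r]%classic (x 0 l)]).
    exact: (measurable_coords (P := fun l => `[corner k z 0 l, corner k z 0 l + r]%classic)).
  by apply/seteqP; split => x /= Hx l; have := Hx l; rewrite in_itv.
have lbox r : 0 <= r -> lam (box r) = ((r ^+ d)%:E : \bar R).
  move=> r0; rewrite /box; have := @lamE (corner k z) (corner k z + const_mx r).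
  rewrite (_ : [set x : V | _] = [set x : V | forall l, corner k z 0 l <= x 0 l <= corner k z 0 l + r]); last first.
    by apply/seteqP; split => x /= H l; have := H l; rewrite !mxE.
  move=> ->; last by move=> l; rewrite !mxE lerDl.
  under eq_bigr do rewrite !mxE addrAC subrr add0r.
  by rewrite prodr_const card_ord.
have ub : (lam (cell k z) <= (k%:R^-1 ^+ d)%:E)%E.
  rewrite -lbox ?invr_ge0//; apply: le_measure; rewrite ?inE//; first exact: measurable_cell.
  move=> x cx l; have := cell_corner l k0 cx; rewrite ler_norml => /andP[_ h1].
  apply/andP; split; last by rewrite -lerBlDl.
  by move: cx; rewrite cellE mxE => /(_ l)/andP[h2 _]; rewrite ler_pdivrMr// mulrC.
have lb (r : R) : 0 < r < 1 -> ((((1 - r) / k%:R) ^+ d)%:E <= lam (cell k z))%E.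
  move=> /andP[r0 r1]; rewrite -lbox; last by rewrite divr_ge0//; lra.
  apply: le_measure; rewrite ?inE//; first exact: measurable_cell.
  move=> x bx; rewrite cellE => l; have := bx l; rewrite mxE -mulrDl => /andP[].
  rewrite ler_pdivrMr// ler_pdivlMr// mulrC intrD => h1 h2.
  by apply/andP; split => //; lra.
have lfin : lam (cell k z) \is a fin_num.
  by rewrite ge0_fin_numE// (le_lt_trans ub)// ltry.
apply/eqP; rewrite eq_le ub /= -(fineK lfin) lee_fin.
apply/ler_addgt0Pl => e e0.
have [c0 d0] : 0 < k%:R^-1 ^+ d :> R /\ (0 < d.+1%:R :> R) by rewrite exprn_gt0 ?invr_gt0.
pose c : R := k%:R^-1 ^+ d.
(* By Bernoulli the box of side (1 - r) / k loses at most a fraction d r of the volume. The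
   denominator has [d.+1] so that d = 0 is harmless, and 1 / 2 keeps [r] below 1. *)
pose r : R := Num.min (e / (c * d.+1%:R)) (1 / 2).
have r0 : 0 < r by rewrite /r lt_min !divr_gt0// mulr_gt0.
have r1 : r < 1 by rewrite /r gt_min [X in _ || X]ltr_pdivrMr// mul1r ltr1n orbT.
have re : c * (d%:R * r) <= e.
  apply: (@le_trans _ _ (r * (c * d.+1%:R))).
    have : 0 <= r * c by rewrite mulr_ge0// ltW.
    rewrite -natr1; lra.
  by rewrite -ler_pdivlMr ?mulr_gt0// /r ge_min lexx.
have r01 : 0 <= r <= 1 by rewrite !ltW.
have := bernoulli_le d r01; have := lb r; rewrite r0 r1 => /(_ isT).
rewrite -{1}(fineK lfin) lee_fin exprMn -/c => h1 h2.
have : c * (1 - d%:R * r) <= c * (1 - r) ^+ d by rewrite ler_wpM2l// ltW.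
rewrite [_ * (1 - r) ^+ d]mulrC mulrBr mulr1; lra.
Qed.

Lemma cell_integral_sum k N (h : V -> R) : (0 < k)%N ->
  measurable_fun [set: B] (h : B -> R) -> (forall x, 0 <= h x) ->
  (\sum_(z <- cells k N) \int[lam]_(x in cell k z) (h x)%:E <=
   \int[lam]_(x in cube N) (h x)%:E)%E.
Proof.
move=> k0 mh h0; have mh' : measurable_fun [set: B] (fun x : B => (h x)%:E) by exact/measurable_EFinP.
rewrite -ge0_integral_bigsetU//=.
- apply: ge0_subset_integral => //.
  + by apply: bigsetU_measurable => z _; exact: measurable_cell.
  + exact: measurable_cube.
  + exact: measurable_funTS.
  + by move=> x _; rewrite lee_fin.
  + rewrite -bigcup_seq; apply: bigcup_sub => z /= zc.
    exact: cells_sub_cube.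
- by move=> z; exact: measurable_cell.
- exact: uniq_boxseq.
- exact: trivIset_cell.
- exact: measurable_funTS.
- by move=> x _; rewrite lee_fin.
Qed.

(** A Lipschitz [phi] that is L1-close to [f] varies by at most |L| / k on a cell, which adds at
    most |L| (2N)^d / k in total. The same [phi] serves all large [k]. *)
Lemma cell_approx (f : V -> R) N : measurable_fun [set: B] (f : B -> R) ->
  lam.-integrable (cube N) (fun x : B => (f x)%:E) ->
  forall e : R, 0 < e -> exists phi L, is_lip L phi /\ exists k0, forall k, (k0 <= k)%N ->
  (\sum_(z <- cells k N) \int[lam]_(x in cell k z) `|f x - phi (corner k z)|%:E <= e%:E)%E.
Proof.
move=> mf intf e e0; have e2 : 0 < e / 2 by rewrite divr_gt0.
have [_ af] := integrable_lip_approx (measurable_cube N) (lam_cube_lty N) mf intf.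
have [phi [L [lphi fphi]]] := af _ e2; exists phi, L; split => //.
pose A := `|L| * (N.*2)%:R ^+ d; exists (Num.truncn (A / (e / 2))).+1 => k hk.
have A0 : 0 <= A by rewrite mulr_ge0.
have k0 : (0 < k)%N by apply: leq_trans hk.
have k1 : 0 < k%:R :> R by rewrite ltr0n.
have Ak : A / k%:R <= e / 2.
  rewrite ler_pdivrMr// mulrC -ler_pdivrMr// ltW//.
  by apply: lt_le_trans (truncnS_gt _) _; rewrite ler_nat.
have mphi := is_lip_measurable lphi.
have mabs g : measurable_fun [set: B] (g : B -> R) -> measurable_fun [set: B] ((fun x => `|f x - g x|) : B -> R).
  by move=> mg; apply: measurableT_comp => //; exact: measurable_funB.
pose h x := `|f x - phi x| + `|L| / k%:R.
have mh : measurable_fun [set: B] (h : B -> R) by apply: measurable_funD => //; exact: mabs.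
have h0 x : 0 <= h x by rewrite addr_ge0// divr_ge0// ltW.
apply: le_trans (_ : \sum_(z <- cells k N) \int[lam]_(x in cell k z) (h x)%:E <= _)%E.
  apply: lee_sum => z _; apply: ge0_le_integral => //; first exact: measurable_cell.
  - by apply/measurable_EFinP/measurable_funTS; exact: mabs.
  - by apply/measurable_EFinP/measurable_funTS.
  - move=> x cx; rewrite lee_fin -(subrKA (phi x)) (le_trans (ler_normD _ _))// /h lerD2l.
    apply: le_trans (lphi _ _ k%:R^-1 _ (fun l => cell_corner l k0 cx)) _; first by rewrite invr_ge0.
    by rewrite ler_wpM2r ?invr_ge0// ler_norm.
apply: (le_trans (cell_integral_sum N k0 mh h0)).
apply: le_trans (_ : \int[lam]_(x in cube N) `|f x - phi x|%:E + \int[lam]_(x in cube N) (`|L| / k%:R)%:E <= _)%E.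
  apply: ge0_integral_le_add => //; first exact: measurable_cube.
  - exact: measurable_funTS.
  - by apply: measurable_funTS; exact: mabs.
rewrite integral_cst; last exact: measurable_cube.
rewrite lam_cube -EFinM mulrAC -/A [e]splitr EFinD; apply: leeD => //.
Qed.

(** For a density of [X] this is the probability of [cellv k X = z], and k^d times it is the average
    of [f] over the cell. *)
Definition mass k (f : V -> R) z : R := fine (\int[lam]_(x in cell k z) (f x)%:E).

Lemma mass_dist k (f : V -> R) z c : (0 < k)%N -> lam.-integrable (cell k z) (fun x : B => (f x)%:E) ->
  (`|mass k f z - k%:R^-1 ^+ d * c|%:E <= \int[lam]_(x in cell k z) `|f x - c|%:E)%E.
Proof.
move=> k0 intf; have mc := measurable_cell k z.
have ic : lam.-integrable (cell k z) (fun=> c%:E : \bar R).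
  apply/integrableP; split => //.
  by rewrite integral_cst// lam_cell// ltry.
have fi : (\int[lam]_(x in cell k z) (f x)%:E \is a fin_num)%E by exact: integrable_fin_num.
have mE : (mass k f z - k%:R^-1 ^+ d * c)%:E = (\int[lam]_(x in cell k z) (f x - c)%R%:E)%E.
  under [RHS]eq_integral do rewrite EFinB.
  by rewrite integralB_EFin// integral_cst// lam_cell// EFinB fineK// -EFinM mulrC.
rewrite -[X in (X <= _)%E]/(`|(mass k f z - k%:R^-1 ^+ d * c)%:E|)%E mE.
apply: (le_abse_integral lam mc (f := fun x : B => (f x - c)%R%:E)).
apply/measurable_EFinP; apply: measurable_funB => //; apply/measurable_EFinP.
exact: measurable_int intf.
Qed.

(** In L1 of a cell, the average of [f] is as good an approximation as any constant [c], up to the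
    factor 2. In the applications [c] is the value of a Lipschitz function at the corner. *)
Lemma mass_l1 k (f : V -> R) z c : (0 < k)%N -> measurable_fun [set: B] (f : B -> R) ->
  lam.-integrable (cell k z) (fun x : B => (f x)%:E) ->
  (\int[lam]_(x in cell k z) `|f x - k%:R ^+ d * mass k f z|%:E <=
   2%:E * \int[lam]_(x in cell k z) `|f x - c|%:E)%E.
Proof.
move=> k0 mf intf; have k1 : 0 < k%:R :> R by rewrite ltr0n.
have kd : 0 < k%:R ^+ d :> R by rewrite exprn_gt0.
have mc := measurable_cell k z.
have mabs c' : measurable_fun (cell k z) ((fun x => `|f x - c'|) : B -> R).
  by apply: measurable_funTS; apply: measurableT_comp => //; exact: measurable_funB.
apply: (@le_trans _ _ (\int[lam]_(x in cell k z) `|f x - c|%:E +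
    \int[lam]_(x in cell k z) `|c - k%:R ^+ d * mass k f z|%:E)%E).
  apply: ge0_integral_le_add => //.
  by move=> x _; rewrite -(subrKA c) ler_normD.
rewrite integral_cst// lam_cell// -[2%:E]/(1%:E + 1%:E)%E ge0_muleDl// !mul1e.
apply: leeD => //; apply: le_trans (mass_dist c k0 intf).
have -> : mass k f z - k%:R^-1 ^+ d * c = k%:R^-1 ^+ d * (k%:R ^+ d * mass k f z - c).
  by rewrite exprVn; field; rewrite gt_eqF.
by rewrite normrM (ger0_norm (exprn_ge0 _ _)) ?invr_ge0// distrC -EFinM mulrC.
Qed.

Lemma cell_approx_mass (f : V -> R) N : measurable_fun [set: B] (f : B -> R) ->
  lam.-integrable (cube N) (fun x : B => (f x)%:E) ->
  forall e : R, 0 < e -> exists phi L, is_lip L phi /\ exists k0, forall k, (k0 <= k)%N -> (0 < k)%N ->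
  \sum_(z <- cells k N) `|mass k f z - k%:R^-1 ^+ d * phi (corner k z)| <= e.
Proof.
move=> mf intf e e0; have [phi [L [lphi [k0 H]]]] := cell_approx mf intf e0.
exists phi, L; split => //; exists k0 => k kk k1; rewrite -lee_fin -sumEFin.
apply: le_trans (H k kk); rewrite big_seq [leRHS]big_seq; apply: lee_sum => z zc.
apply: mass_dist => //; apply: integrableS intf; [exact: measurable_cube|exact: measurable_cell|].
exact: cells_sub_cube.
Qed.

(** Both masses are replaced by values of one Lipschitz function at the corners, which differ by
    O(1/k). The two replacements and this difference cost e / 3 each. Shifted cells may leave
    [cells k N], but stay in [cells k N.+1] once [k] exceeds the entries of [s]. *)
Lemma mass_shift (f : V -> R) N (s : 'rV[int]_d) : measurable_fun [set: B] (f : B -> R) ->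
  lam.-integrable (cube N.+1) (fun x : B => (f x)%:E) ->
  forall e : R, 0 < e -> exists k0, forall k, (k0 <= k)%N ->
  \sum_(z <- cells k N) `|mass k f z - mass k f (z - s)| <= e.
Proof.
move=> mf intf e e0; have e3 : 0 < e / 3 by rewrite divr_gt0.
have [phi [L [lphi [k0 H]]]] := cell_approx_mass mf intf e3.
pose S := (\sum_l absz (s 0%R l))%N.
have sS l : (absz (s 0%R l) <= S)%N by rewrite /S (bigD1 l)//= leq_addr.
pose A := (N.*2)%:R ^+ d * (`|L| * S%:R).
exists (maxn (maxn k0 S) (Num.truncn (A / (e / 3))).+1) => k; rewrite !geq_max => /andP[/andP[kk kS] kA].
have kp : (0 < k)%N by apply: leq_trans kA.
have k1 : 0 < k%:R :> R by rewrite ltr0n.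
have A0 : 0 <= A by rewrite !mulr_ge0.
have Ak : A / k%:R <= e / 3.
  rewrite ler_pdivrMr// mulrC -ler_pdivrMr// ltW//.
  by apply: lt_le_trans (truncnS_gt _) _; rewrite ler_nat.
pose G z := `|mass k f z - k%:R^-1 ^+ d * phi (corner k z)|.
have G0 z : 0 <= G z by exact: normr_ge0.
have sub1 : {subset cells k N <= cells k N.+1}.
  by move=> z; rewrite !mem_cells => /forallP zb; apply/forallP => l; have := zb l; nia.
have sub2 : {subset [seq z - s | z <- cells k N] <= cells k N.+1}.
  move=> _ /mapP[z + ->]; rewrite !mem_cells => /forallP zb; apply/forallP => l; rewrite !mxE.
  have := zb l; have := sS l; move: (z 0 l) (s 0 l) => x y; nia.
have sum1 : \sum_(z <- cells k N) G z <= e / 3.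
  apply: le_trans (H k kk kp); apply: uniq_ler_sum => //; exact: uniq_boxseq.
have sum2 : \sum_(z <- cells k N) G (z - s) <= e / 3.
  rewrite -(big_map (fun z => z - s) xpredT G).
  apply: le_trans (H k kk kp); apply: uniq_ler_sum => //; last exact: uniq_boxseq.
  by rewrite map_inj_uniq ?uniq_boxseq//; exact: addIr.
have sum3 : \sum_(z <- cells k N) k%:R^-1 ^+ d * `|phi (corner k z) - phi (corner k (z - s))| <= e / 3.
  apply: le_trans (_ : \sum_(z <- cells k N) k%:R^-1 ^+ d * (`|L| * (S%:R / k%:R)) <= _).
    apply: ler_sum => z _; rewrite ler_wpM2l ?exprn_ge0 ?invr_ge0//.
    apply: (@le_trans _ _ (L * (S%:R / k%:R))); last by rewrite ler_wpM2r ?divr_ge0// ler_norm.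
    apply: lphi => [|l]; first by rewrite divr_ge0.
    rewrite !mxE -mulrBl -intrB opprB addrC subrK normrM normfV (gtr0_norm k1).
    by rewrite ler_pM2r ?invr_gt0// -intr_norm -(abszE (s 0 l)) ler_nat.
  rewrite big_const_seq count_predT size_cells iter_addr_0 -[_ *+ _]mulr_natl.
  apply: le_trans Ak; rewrite /A -muln2 -mulnA mulnC natrX !natrM !exprMn.
  rewrite le_eqVlt; apply/orP; left; apply/eqP; rewrite -muln2 natrM exprMn exprVn; field.
  by rewrite ?expf_neq0 ?gt_eqF.
have -> : e = e / 3 + e / 3 + e / 3 by field.
apply: le_trans (lerD (lerD sum1 sum2) sum3); rewrite -!big_split/=; apply: ler_sum => z _.
rewrite /G; set u := mass k f z; set v := mass k f (z - s); set x := phi _; set y := phi _.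
set c := _ ^+ d; have c0 : 0 <= c by rewrite exprn_ge0 ?invr_ge0.
have -> : c * `|x - y| = `|c * (x - y)| by rewrite normrM (ger0_norm c0).
rewrite (_ : u - v = (u - c * x) - (v - c * y) + c * (x - y)); last by ring.
by rewrite (le_trans (ler_normD _ _))// lerD// ler_normB.
Qed.

Lemma mass_ge0 k (g : V -> R) z : (forall x, 0 <= g x) -> 0 <= mass k g z.
Proof. by move=> g0; apply: fine_ge0; apply: integral_ge0 => x _; rewrite lee_fin. Qed.

End cells.

(** * Riemann sums of entropies *)

Section eta_measurable.
Context {R : realType}.

Lemma eta_ln : (@eta R) = fun t => - (t * ln t).
Proof.
apply/funext => t; have [t0|t0] := leP t 0; last exact: etaE.
by rewrite /eta !ln0 ?mulr0 ?oppr0// invr_le0.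
Qed.

Lemma measurable_eta : measurable_fun [set: R] (@eta R).
Proof.
rewrite eta_ln; apply: measurableT_comp; first exact: oppr_measurable.
apply: measurable_funM => //.
Qed.

End eta_measurable.

Section integral_tools.
Context {dT : measure_display} {T : measurableType dT} {R : realType}.
Variable mu : {measure set T -> \bar R}.
Implicit Types (D E : set T) (f g u : T -> R).

Lemma bounded_integrable D f A : measurable D -> (mu D < +oo)%E ->
  measurable_fun [set: T] f -> (forall x, D x -> `|f x| <= A) ->
  mu.-integrable D (fun x => (f x)%:E).
Proof.
move=> mD Doo mf fA; apply: (@le_integrable _ _ _ mu D mD _ (fun=> `|A|%:E)).
- by apply/measurable_EFinP; exact: measurable_funTS.
- by move=> x Dx; rewrite /= lee_fin normr_id (le_trans (fA x Dx))// ler_norm.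
- apply/integrableP; split => //; under eq_integral do rewrite /= normr_id.
  by rewrite integral_cst// lte_mul_pinfty// lee_fin.
Qed.

(** Test the hypothesis on the set where f < g; finiteness of the integral of [g] allows the
    cancellation. *)
Lemma ge0_integral_pos_part f g : measurable_fun [set: T] f -> measurable_fun [set: T] g ->
  (forall x, 0 <= g x) -> (forall x, 0 <= f x) ->
  (\int[mu]_x (g x)%:E < +oo)%E ->
  (forall D, measurable D -> (\int[mu]_(x in D) (g x)%:E <= \int[mu]_(x in D) (f x)%:E)%E) ->
  (\int[mu]_x (Num.max (g x - f x) 0)%:E = 0)%E.
Proof.
move=> mf mg g0 f0 goo gf; pose E := [set x | f x < g x].
have mE : measurable E.
  have := measurable_fun_ltr mf mg; rewrite /E => /(_ measurableT [set true]) /=.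
  rewrite setTI (_ : _ @^-1` _ = [set x | f x < g x]); last by apply/seteqP; split.
  exact.
have mm : measurable_fun [set: T] (fun x => Num.max (g x - f x) 0).
  by apply: measurable_maxr => //; exact: measurable_funB.
have m0 x : 0 <= Num.max (g x - f x) 0 by rewrite le_max lexx orbT.
rewrite -(setUv E) ge0_integral_setU//; last 4 first.
- exact: measurableC.
- by rewrite setUv; exact/measurable_EFinP.
- by move=> x _; rewrite lee_fin.
- by rewrite disj_set2E setICr.
rewrite [X in (_ + X)%E]integral0_eq ?adde0; last first.
  by move=> x /= /negP; rewrite -leNgt => h; congr EFin; apply: max_idPr; rewrite subr_le0.
have mE1 h : measurable_fun [set: T] h -> measurable_fun E (fun x => (h x)%:E).
  by move=> mh; apply/measurable_EFinP; exact: measurable_funTS.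
have : (\int[mu]_(x in E) (g x)%:E = \int[mu]_(x in E) (f x)%:E +
    \int[mu]_(x in E) (Num.max (g x - f x) 0)%:E)%E.
  rewrite -ge0_integralD//; last 4 first.
  - by move=> x _; rewrite lee_fin.
  - exact: mE1.
  - by move=> x _; rewrite lee_fin.
  - exact: mE1.
  apply: eq_integral => x; rewrite inE /E /= => h; rewrite -EFinD.
  by rewrite (max_idPl _) ?subr_ge0 ?ltW// addrC subrK.
have gEoo : (\int[mu]_(x in E) (g x)%:E < +oo)%E.
  apply: le_lt_trans goo; apply: ge0_subset_integral => //.
  - exact/measurable_EFinP.
  - by move=> x _; rewrite lee_fin.
have gE0 : (0 <= \int[mu]_(x in E) (g x)%:E)%E by apply: integral_ge0 => x _; rewrite lee_fin.
have fE0 : (0 <= \int[mu]_(x in E) (f x)%:E)%E by apply: integral_ge0 => x _; rewrite lee_fin.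
have hE0 : (0 <= \int[mu]_(x in E) (Num.max (g x - f x) 0)%:E)%E.
  by apply: integral_ge0 => x _; rewrite lee_fin.
have := gf E mE.
case: (\int[mu]_(x in E) (g x)%:E)%E gEoo gE0 => [a _ _|//|//].
case: (\int[mu]_(x in E) (f x)%:E)%E fE0 => [b _|_|//].
- case: (\int[mu]_(x in E) _)%E hE0 => [c|//|//].
  by rewrite !lee_fin => c0 ab [abc]; congr EFin; lra.
- by case: (\int[mu]_(x in E) _)%E hE0.
Qed.

(** When [g] is a density bounded by [f] almost everywhere, the minimum is a version of it for which
    the bound holds at every point. *)
Lemma integral_min_pos_part f g D : measurable D ->
  measurable_fun [set: T] f -> measurable_fun [set: T] g ->
  (forall x, 0 <= g x) -> (forall x, 0 <= f x) ->
  (\int[mu]_x (Num.max (g x - f x) 0)%:E = 0)%E ->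
  (\int[mu]_(x in D) (Num.min (g x) (f x))%:E = \int[mu]_(x in D) (g x)%:E)%E.
Proof.
move=> mD mf mg g0 f0 h0.
have mm : measurable_fun [set: T] (fun x => Num.max (g x - f x) 0).
  by apply: measurable_maxr => //; exact: measurable_funB.
have m0 x : 0 <= Num.max (g x - f x) 0 by rewrite le_max lexx orbT.
have mn : measurable_fun [set: T] (fun x => Num.min (g x) (f x)) by exact: measurable_minr.
have n0 x : 0 <= Num.min (g x) (f x) by rewrite le_min g0 f0.
have hD : (\int[mu]_(x in D) (Num.max (g x - f x) 0)%:E = 0)%E.
  apply/eqP; rewrite eq_le; apply/andP; split; last by apply: integral_ge0 => x _; rewrite lee_fin.
  rewrite -h0; apply: ge0_subset_integral => //.
  - exact/measurable_EFinP.
  - by move=> x _; rewrite lee_fin.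
rewrite -[LHS]adde0 -hD -ge0_integralD//; last 4 first.
- by move=> x _; rewrite lee_fin.
- by apply/measurable_EFinP; exact: measurable_funTS.
- by move=> x _; rewrite lee_fin.
- by apply/measurable_EFinP; exact: measurable_funTS.
apply: eq_integral => x _; rewrite -EFinD; congr EFin.
by rewrite minEle maxEle; case: ifPn; case: ifPn; rewrite -?ltNge; lra.
Qed.

Lemma integrable_tail (G : T -> R) (E : (set T)^nat) : mu.-integrable [set: T] (fun x => (G x)%:E) ->
  (forall x, 0 <= G x) -> (forall n, measurable (E n)) ->
  (forall x, exists n0, forall n, (n0 <= n)%N -> E n x) ->
  forall e : R, 0 < e -> exists n, (\int[mu]_x (\1_(~` E n) x * G x)%:E <= e%:E)%E.
Proof.
move=> iG G0 mE Ex e e0.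
have mG : measurable_fun [set: T] G by apply/measurable_EFinP; exact: measurable_int iG.
have mf n : measurable_fun [set: T] (fun x => (\1_(~` E n) x * G x)%:E).
  apply/measurable_EFinP; apply: measurable_funM => //; apply: measurable_indic; exact: measurableC.
have [] // := @dominated_convergence _ _ _ mu setT measurableT
  (fun n x => (\1_(~` E n) x * G x)%:E) (cst 0%E) (fun x => (G x)%:E).
- apply: aeW => x _; have [n0 H] := Ex x; apply: cvg_near_cst.
  exists n0 => // n /= nn; rewrite indicE memNset ?mul0r//.
  by move=> h; apply: h; exact: H.
- apply: aeW => x n _; rewrite /= lee_fin normrM (ger0_norm (G0 x)) ger0_norm//.
  by apply: ler_piMl => //; rewrite indicE; case: (_ \in _).
move=> _ _; rewrite integral0 => /fine_cvgP[[n0 _ fin] /cvgrPdist_le/(_ e e0)[n1 _ small]].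
pose n := maxn n0 n1; exists n.
have := small n (leq_maxr _ _); rewrite /= sub0r normrN => h.
have := fin n (leq_maxl _ _) => /= fi.
by rewrite -(fineK fi) lee_fin; apply: le_trans h; rewrite ler_norm.
Qed.

Lemma fine_integral_dist f g : mu.-integrable [set: T] (fun x => (f x)%:E) ->
  mu.-integrable [set: T] (fun x => (g x)%:E) ->
  (`|fine (\int[mu]_x (f x)%:E) - fine (\int[mu]_x (g x)%:E)|%:E <= \int[mu]_x `|f x - g x|%:E)%E.
Proof.
move=> fi gi.
have ff : (\int[mu]_x (f x)%:E \is a fin_num)%E by exact: integrable_fin_num.
have gf : (\int[mu]_x (g x)%:E \is a fin_num)%E by exact: integrable_fin_num.
rewrite -[X in (X <= _)%E]/(`|(fine (\int[mu]_x (f x)%:E) - fine (\int[mu]_x (g x)%:E))%:E|)%E.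
rewrite EFinB !fineK// -integralB_EFin//.
under eq_integral do rewrite -EFinB.
apply: (le_abse_integral mu measurableT (f := fun x => (f x - g x)%R%:E)).
by apply/measurable_EFinP; apply: measurable_funB; apply/measurable_EFinP; [exact: measurable_int fi|exact: measurable_int gi].
Qed.

End integral_tools.

Section cell_sums.
Context {R : realType} {d : nat}.
Notation V := 'rV[R]_d.
Notation B := (BorelRd R d).
Variable lam : {measure set B -> \bar R}.
Hypothesis lamE : lebesgue_Rd lam.

Lemma cellv_mem_cells k N N' (x : V) : (0 < k)%N -> (N < N')%N -> cube N x ->
  cellv k x \in cells k N'.
Proof.
move=> k0 NN /= cx; rewrite mem_cells; apply/forallP => l; rewrite mxE.
have k1 : 0 < k%:R :> R by rewrite ltr0n.
have /andP[h1 h2] := cx l; apply/andP; split.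
  rewrite floor_ge_int mulrNz -[(Posz _)%:~R]/((k * N')%:R : R) natrM -mulrN ler_pM2l//.
  by apply: le_trans h1; rewrite lerN2 ler_nat ltnW.
rewrite floor_lt_int -[(Posz _)%:~R]/((k * N')%:R : R) natrM ltr_pM2l//.
by apply: (le_lt_trans h2); rewrite ltr_nat.
Qed.

Lemma integral_cells k N N' (h : V -> R) : (0 < k)%N -> (N < N')%N ->
  measurable_fun [set: B] (h : B -> R) -> (forall x, ~ cube N x -> h x = 0) ->
  (\int[lam]_x (h x)%:E = \sum_(z <- cells k N') \int[lam]_(x in cell k z) (h x)%:E)%E.
Proof.
move=> k0 NN mh h0; have mh' : measurable_fun [set: B] (fun x : B => (h x)%:E) by exact/measurable_EFinP.
rewrite -(@integral_bigsetU_EFin _ _ _ lam _ (cell k) h).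
- rewrite [RHS]integral_mkcond; apply: eq_integral => x _; rewrite patchE.
  case: ifPn => // /negP xU; rewrite h0// => cx; apply: xU; rewrite inE -bigcup_seq.
  by exists (cellv k x) => //=; exact: cellv_mem_cells cx.
- by move=> z; exact: measurable_cell.
- exact: uniq_boxseq.
- exact: trivIset_cell.
- exact: measurable_funTS.
Qed.

Lemma lam_cell_lty k z : (0 < k)%N -> (lam (cell k z) < +oo)%E.
Proof. by move=> k0; rewrite (lam_cell lamE)// ltry. Qed.

Lemma mass_le k z (g : V -> R) M : (0 < k)%N -> measurable_fun [set: B] (g : B -> R) ->
  (forall x, 0 <= g x <= M) -> k%:R ^+ d * mass lam k g z <= M.
Proof.
move=> k0 mg gM; have k1 : 0 < k%:R :> R by rewrite ltr0n.
have kd : 0 < k%:R ^+ d :> R by rewrite exprn_gt0.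
have mc : measurable (cell k z : set B) := measurable_cell k z.
have ub : (\int[lam]_(x in cell k z) (g x)%:E <= (k%:R^-1 ^+ d * M)%:E)%E.
  rewrite mulrC EFinM -(lam_cell lamE z k0) -integral_cst//; apply: ge0_le_integral => //.
  - by move=> x _; rewrite lee_fin; have /andP[] := gM x.
  - by apply/measurable_EFinP; exact: measurable_funTS.
  - by move=> x _; rewrite lee_fin; have /andP[] := gM x.
have : mass lam k g z <= k%:R^-1 ^+ d * M.
  rewrite -lee_fin /mass fineK// ge0_fin_numE; first by rewrite (le_lt_trans ub)// ltry.
  by apply: integral_ge0 => x _; rewrite lee_fin; have /andP[] := gM x.
by rewrite exprVn -ler_pdivlMl// mulrC.
Qed.

(** On each cell [eta] of the average is compared with the integral of [eta (g x)]. As [eta_modulus]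
    is affine in the distance, the total error is a multiple of the volume plus a multiple of the L1
    distance between [g] and its cell averages. *)
Lemma riemann_eta (g : V -> R) M N N' : measurable_fun [set: B] (g : B -> R) ->
  (forall x, 0 <= g x <= M) -> 0 < M -> (N < N')%N -> (forall x, ~ cube N x -> g x = 0) ->
  forall e : R, 0 < e -> exists k0, forall k, (k0 <= k)%N -> (0 < k)%N ->
  `|\sum_(z <- cells k N') k%:R^-1 ^+ d * eta (k%:R ^+ d * mass lam k g z)
    - fine (\int[lam]_x (eta (g x))%:E)| <= e.
Proof.
move=> mg gM M0 NN g0 e e0.
pose A : R := (N'.*2)%:R ^+ d; have A0 : 0 <= A by rewrite exprn_ge0.
(* [A] is the total volume of the cells, so [r] costs at most e / 2. The L1 error is doubled by
   [mass_l1], which explains the e / 4 in [s]; [s] comes second because [C] depends on [r]. *)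
pose r := e / 2 / (A + 1); have r0 : 0 < r by rewrite !divr_gt0// ltr_wpDl.
have [C C0 HC] := eta_modulus M0 r0.
pose s := e / 4 / (C + 1); have s0 : 0 < s by rewrite !divr_gt0// ltr_wpDl.
have gi (D : set B) : measurable D -> (lam D < +oo)%E -> lam.-integrable D (fun x : B => (g x)%:E).
  move=> mD Doo; apply: bounded_integrable => // x _; have /andP[h1 h2] := gM x.
  rewrite ger0_norm; [exact: h2|exact: h1].
have gic := gi _ (measurable_cube N') (lam_cube_lty lamE N').
have [phi [L [lphi [k0 Hk]]]] := cell_approx lamE mg gic s0.
exists k0 => k kk k1; have kd : 0 < k%:R^-1 ^+ d :> R by rewrite exprn_gt0// invr_gt0 ltr0n.
have meg : measurable_fun [set: B] ((fun x => eta (g x)) : B -> R).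
  by apply: measurableT_comp => //; exact: measurable_eta.
have egi z : lam.-integrable (cell k z) (fun x : B => (eta (g x))%:E).
  apply: (bounded_integrable (A := r + C * M)) => //; first exact: measurable_cell.
    exact: lam_cell_lty.
  move=> x _; have /andP[h1 h2] := gM x.
  have := HC (g x) 0; rewrite eta0 !subr0 lexx (ltW M0) h1 h2 => /(_ isT isT) /le_trans; apply.
  by rewrite lerD2l ler_wpM2l// ger0_norm.
have -> : fine (\int[lam]_x (eta (g x))%:E) = \sum_(z <- cells k N') mass lam k (fun x => eta (g x)) z.
  rewrite (@integral_cells k N N')//; last by move=> x /g0 ->; exact: eta0.
  rewrite /mass -sum_fine// => z _; apply: integrable_fin_num => //; exact: measurable_cell.
rewrite -sumrB; apply: le_trans (ler_norm_sum _ _ _) _.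
pose J z := (\int[lam]_(x in cell k z) `|g x - phi (corner k z)|%:E)%E.
have J0 z : (0 <= J z)%E by apply: integral_ge0 => x _; rewrite lee_fin.
have H1 z : (`|k%:R^-1 ^+ d * eta (k%:R ^+ d * mass lam k g z) - mass lam k (fun x => eta (g x)) z|%:E
    <= (k%:R^-1 ^+ d * r)%:E + C%:E * (2%:E * J z))%E.
  have mc : measurable (cell k z : set B) := measurable_cell k z.
  set m := k%:R ^+ d * mass lam k g z.
  have mM : 0 <= m <= M.
    apply/andP; split; last exact: mass_le.
    by rewrite mulr_ge0// ?mass_ge0// => x; have /andP[] := gM x.
  have mabs : measurable_fun (cell k z) ((fun x => `|g x - m|) : B -> R).
    by apply: measurable_funTS; apply: measurableT_comp => //; exact: measurable_funB.
  rewrite distrC; apply: le_trans (mass_dist lamE (eta m) k1 (egi z)) _.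
  apply: (@le_trans _ _ (\int[lam]_(x in cell k z) r%:E + \int[lam]_(x in cell k z) (C * `|g x - m|)%:E)%E).
    apply: ge0_integral_le_add => //.
    - by apply: measurable_funTS; apply: measurableT_comp => //; exact: measurable_funB.
    - by apply: measurable_funM.
    - by move=> x; exact: ltW.
    - by move=> x; rewrite mulr_ge0.
    - by move=> x _; exact: HC.
  rewrite integral_cst// (lam_cell lamE z k1) -EFinM mulrC; apply: leeD => //.
  under eq_integral do rewrite EFinM.
  rewrite ge0_integralZl_EFin//; last exact/measurable_EFinP.
  apply: lee_wpmul2l; first by rewrite lee_fin.
  by apply: mass_l1 => //; apply: gi => //; exact: lam_cell_lty.
rewrite -lee_fin -sumEFin; apply: le_trans (lee_sum _ (fun z _ => H1 z)) _.
rewrite big_split/= sumEFin -ge0_sume_distrr; last by move=> z _; rewrite mule_ge0.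
rewrite -ge0_sume_distrr//.
apply: (@le_trans _ _ ((A * r)%:E + C%:E * (2%:E * s%:E))%E).
  apply: leeD.
    rewrite big_const_seq count_predT size_cells iter_addr_0 -[_ *+ _]mulr_natl lee_fin.
    rewrite /A mulrA ler_wpM2r ?(ltW r0)// -muln2 -mulnA muln2 natrX natrM -exprMn.
    by rewrite mulrAC mulfV ?mul1r// gt_eqF// ltr0n.
  apply: lee_wpmul2l; first by rewrite lee_fin.
  by apply: lee_wpmul2l => //; exact: Hk.
rewrite -!EFinM -EFinD lee_fin.
have h1 : A * r <= e / 2.
  by rewrite /r mulrCA ger_pMr ?divr_gt0// ler_pdivrMr ?ltr_wpDl// mul1r lerDl.
have h2 : C * s <= e / 4.
  by rewrite /s mulrCA ger_pMr ?divr_gt0// ler_pdivrMr ?ltr_wpDl// mul1r lerDl.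
lra.
Qed.

(** Takes the place of Lebesgue differentiation: if the average on a cell is at most [M], then the
    positive part of g - M is at most the distance of [g] to that average, and by [mass_l1] and
    [cell_approx] these distances have arbitrarily small total integral. *)
Lemma bounded_by_mass (g : V -> R) M N : measurable_fun [set: B] (g : B -> R) ->
  (forall x, 0 <= g x) -> (forall x, ~ cube N x -> g x = 0) -> 0 <= M ->
  lam.-integrable [set: B] (fun x : B => (g x)%:E) ->
  (forall k z, (0 < k)%N -> k%:R ^+ d * mass lam k g z <= M) ->
  (\int[lam]_x (Num.max (g x - M) 0)%:E = 0)%E.
Proof.
move=> mg g0 gN M0 gi gM.
have mm : measurable_fun [set: B] ((fun x => Num.max (g x - M) 0) : B -> R).
  by apply: measurable_maxr => //; exact: measurable_funB.
have m0 x : 0 <= Num.max (g x - M) 0 by rewrite le_max lexx orbT.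
apply/eqP; rewrite eq_le; apply/andP; split; last by apply: integral_ge0 => x _; rewrite lee_fin.
apply/lee_addgt0Pr => e e0; rewrite add0e.
have e2 : 0 < e / 2 by rewrite divr_gt0.
have gS (D : set B) : measurable D -> lam.-integrable D (fun x : B => (g x)%:E).
  by move=> mD; apply: integrableS gi.
have [phi [L [lphi [k0 Hk]]]] := cell_approx lamE mg (gS _ (measurable_cube N.+1)) e2.
pose k := k0.+1; rewrite (@integral_cells k N N.+1)//; last first.
  by move=> x /gN ->; rewrite (max_idPr _)// sub0r oppr_le0.
apply: (@le_trans _ _ (\sum_(z <- cells k N.+1) 2%:E *
    \int[lam]_(x in cell k z) `|g x - phi (corner k z)|%:E)%E).
  apply: lee_sum => z _; have mc : measurable (cell k z : set B) := measurable_cell k z.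
  apply: le_trans _ (mass_l1 lamE (phi (corner k z)) (ltn0Sn _) mg (gS _ mc)).
  apply: ge0_le_integral => //.
  - by move=> x _; rewrite lee_fin.
  - by apply/measurable_EFinP; exact: measurable_funTS.
  - apply/measurable_EFinP; apply: measurable_funTS; apply: measurableT_comp => //.
    exact: measurable_funB.
  - move=> x _; rewrite lee_fin ge_max normr_ge0 andbT.
    by apply: le_trans (ler_norm _); rewrite lerB// gM.
rewrite -ge0_sume_distrr => [|z _]; last by apply: integral_ge0 => x _; rewrite lee_fin.
apply: (@le_trans _ _ (2%:E * (e / 2)%:E)%E).
  by apply: lee_wpmul2l => //; exact: Hk (leqnSn _).
by rewrite -EFinM lee_fin mulrC divfK.
Qed.

(** Off a set [E n] where both x and f x are bounded, the tail of an integrable majorant is small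
    uniformly in [g]; on [E n], [eta_modulus] converts L1 closeness into closeness of entropies. *)
Lemma eta_integral_close (f : V -> R) : measurable_fun [set: B] (f : B -> R) ->
  (forall x, 0 <= f x) -> lam.-integrable [set: B] (fun x : B => (f x)%:E) ->
  lam.-integrable [set: B] (fun x : B => (eta (f x))%:E) ->
  forall e : R, 0 < e -> exists2 del : R, 0 < del & forall g : V -> R,
    measurable_fun [set: B] (g : B -> R) -> (forall x, 0 <= g x <= 2 * f x) ->
    (\int[lam]_x `|g x - f x|%:E <= del%:E)%E ->
    lam.-integrable [set: B] (fun x : B => (eta (g x))%:E) /\
    `|fine (\int[lam]_x (eta (g x))%:E) - fine (\int[lam]_x (eta (f x))%:E)| <= e.
Proof.
move=> mf f0 fi ei e e0.
have e3 : 0 < e / 3 by rewrite divr_gt0.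
(* By [eta_dominated], |eta (g x)| is at most 2 |eta (f x)| + 2 f x; one more |eta (f x)| majorizes
   the difference. *)
pose G x := 3 * `|eta (f x)| + 2 * f x.
have mef (h : V -> R) : measurable_fun [set: B] (h : B -> R) -> measurable_fun [set: B] ((fun x => eta (h x)) : B -> R).
  by move=> mh; apply: measurableT_comp => //; exact: measurable_eta.
have G0 x : 0 <= G x by rewrite addr_ge0// mulr_ge0.
have iG : lam.-integrable [set: B] (fun x : B => (G x)%:E).
  rewrite /G; under eq_fun do rewrite EFinD !EFinM.
  apply: integrableD => //; apply: integrableZl => //.
  exact: (integrable_abse ei).
pose E n : set B := cube n `&` [set x | f x <= n%:R].
have mE n : measurable (E n).
  apply: measurableI; first exact: measurable_cube.
  rewrite -[X in measurable X]setTI (_ : [set x | _] = f @^-1` `]-oo, n%:R]); first exact: mf.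
  by apply/seteqP; split => x /=; rewrite in_itv.
have [|n En] := integrable_tail iG G0 mE _ e3.
  move=> x; pose S := `|f x| + \sum_l `|x 0 l|.
  exists (Num.truncn S).+1 => n nn.
  have Sn : S < n%:R by apply: lt_le_trans (truncnS_gt _) _; rewrite ler_nat.
  have fS : `|f x| <= S by rewrite lerDl sumr_ge0.
  have xS l : `|x 0 l| <= S by rewrite /S (bigD1 l)//= addrCA lerDl addr_ge0// sumr_ge0.
  split => /= [l|]; last by rewrite (le_trans (ler_norm _))// (le_trans fS)// ltW.
  by rewrite -ler_norml (le_trans (xS l))// ltW.
pose A : R := (n.*2)%:R ^+ d; have A0 : 0 <= A by rewrite exprn_ge0.
pose r := e / 3 / (A + 1); have r0 : 0 < r by rewrite !divr_gt0// ltr_wpDl.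
(* On [E n] the values of [g] are at most 2n; the added 1 makes the bound positive when n = 0. *)
have M0 : 0 < 2 * n%:R + 1 :> R by rewrite ltr_wpDl// mulr_ge0.
have [C C0 HC] := eta_modulus M0 r0.
exists (e / 3 / (C + 1)); first by rewrite !divr_gt0// ltr_wpDl.
move=> g mg gf gdel.
have egi : lam.-integrable [set: B] (fun x : B => (eta (g x))%:E).
  apply: le_integrable iG => //; first by apply/measurable_EFinP; exact: mef.
  move=> x _; rewrite /= lee_fin (ger0_norm (G0 x)) (le_trans (eta_dominated (gf x)))//.
  by rewrite lerD2r ler_wpM2r// ler_nat.
split => //; rewrite -lee_fin; apply: le_trans (fine_integral_dist egi ei) _.
have mabs (h1 h2 : V -> R) : measurable_fun [set: B] (h1 : B -> R) -> measurable_fun [set: B] (h2 : B -> R) ->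
    measurable_fun [set: B] ((fun x => `|h1 x - h2 x|) : B -> R).
  by move=> *; apply: measurableT_comp => //; exact: measurable_funB.
have mtail : measurable_fun [set: B] ((fun x => \1_(~` E n) x * G x) : B -> R).
  apply: measurable_funM; first by apply: measurable_indic; exact: measurableC.
  by apply/measurable_EFinP; exact: measurable_int iG.
have mind : measurable_fun [set: B] ((fun x => r * \1_(E n) x) : B -> R).
  by apply: measurable_funM => //; exact: measurable_indic.
have m1 : measurable_fun [set: B] ((fun x => C * `|g x - f x|) : B -> R).
  by apply: measurable_funM => //; exact: mabs.
have ind0 (D : set B) (x : B) : 0 <= \1_D x :> R by rewrite indicE; case: (_ \in _).
apply: (@le_trans _ _ (\int[lam]_x (r * \1_(E n) x + C * `|g x - f x|)%:E +
    \int[lam]_x (\1_(~` E n) x * G x)%:E)%E).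
  apply: ge0_integral_le_add => //.
  - by apply: mabs; exact: mef.
  - exact: measurable_funD.
  - by move=> x; rewrite addr_ge0// mulr_ge0// ltW.
  - by move=> x; rewrite mulr_ge0.
  - move=> x _; rewrite !indicE in_setC; have /andP[g0 g2] := gf x.
    have [/set_mem [_ /= fn]|_] := boolP (x \in E n).
      rewrite /= mulr1 mul0r addr0; apply: HC; apply/andP; split => //; last by lra.
      by apply: (le_trans g2); lra.
    rewrite /= mulr0 add0r mul1r; apply: ler_wpDl; first by rewrite mulr_ge0.
    apply: (le_trans (ler_normB _ _)); rewrite /G.
    by have := eta_dominated (gf x); lra.
apply: (@le_trans _ _ ((\int[lam]_x (r * \1_(E n) x)%:E + \int[lam]_x (C * `|g x - f x|)%:E) +
    \int[lam]_x (\1_(~` E n) x * G x)%:E)%E).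
  apply: leeD => //; apply: ge0_integral_le_add => //.
  - exact: measurable_funD.
  - by move=> x; rewrite addr_ge0// mulr_ge0// ltW.
  - by move=> x; rewrite mulr_ge0// ltW.
  - by move=> x; rewrite mulr_ge0.
have -> : e%:E = ((e / 3)%:E + (e / 3)%:E + (e / 3)%:E)%E by rewrite -!EFinD; congr EFin; field.
apply: leeD => //; apply: leeD.
  under eq_integral do rewrite EFinM.
  rewrite ge0_integralZl_EFin//; last 2 first.
  - by apply/measurable_EFinP; exact: measurable_indic.
  - exact: ltW.
  rewrite integral_indic// setIT.
  apply: (@le_trans _ _ (r%:E * A%:E)%E).
    apply: lee_wpmul2l; first by rewrite lee_fin ltW.
    rewrite -(lam_cube lamE n); apply: le_measure; rewrite ?inE//; first exact: measurable_cube.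
    exact: subIsetl.
  by rewrite -EFinM lee_fin mulrC /r mulrCA ger_pMr ?divr_gt0// ler_pdivrMr ?ltr_wpDl// mul1r lerDl.
under eq_integral do rewrite EFinM.
rewrite ge0_integralZl_EFin//; last by apply/measurable_EFinP; exact: mabs.
apply: (le_trans (lee_wpmul2l _ gdel)); first by rewrite lee_fin.
by rewrite -EFinM lee_fin mulrCA ger_pMr// ler_pdivrMr ?ltr_wpDl// mul1r lerDl.
Qed.

End cell_sums.

(** * Discrete laws and integer linear combinations *)

Section discrete_law.
Context {dT : measure_display} {T : measurableType dT} {R : realType}.
Variable P : probability T R.

Definition pev (A : set T) : R := fine (P A).

Lemma pevE A : measurable A -> P A = (pev A)%:E.
Proof. by move=> mA; rewrite /pev fineK// fin_num_measure. Qed.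

Lemma pev_ge0 A : 0 <= pev A. Proof. exact: fine_ge0. Qed.

Lemma pev_le1 A : measurable A -> pev A <= 1.
Proof. by move=> mA; rewrite -lee_fin -pevE// probability_le1. Qed.

Context {C : countType}.
Implicit Types (Y : T -> C) (D : set C) (S : seq C).

Definition disc Y := forall c, measurable (Y @^-1` [set c]).

Lemma disc_measurable Y D : disc Y -> measurable (Y @^-1` D).
Proof.
move=> mY; rewrite (_ : _ @^-1` _ = \bigcup_(c in D) (Y @^-1` [set c])); last first.
  by apply/seteqP; split => x; [exists (Y x)|move=> [c Dc xc]; rewrite /preimage/= (xc : Y x = c)].
rewrite bigcup_mkcond; apply: countable_bigcupT_measurable => [|c].
  exact: countableP.
by case: ifP.
Qed.

Definition pr Y c : R := pev (Y @^-1` [set c]).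

Definition supported Y S := P (Y @^-1` [set c | c \notin S]) = 0%E.

Lemma pr_ge0 Y c : 0 <= pr Y c. Proof. exact: pev_ge0. Qed.

Lemma pr_event Y S D : disc Y -> uniq S -> supported Y S ->
  pev (Y @^-1` D) = \sum_(c <- S | c \in D) pr Y c.
Proof.
move=> mY uS YS.
have mD := disc_measurable _ mY.
have H : P (Y @^-1` (D `&` [set` S])) = (\sum_(c <- S | c \in D) pr Y c)%:E.
  elim: S uS {YS} => [_|c S IH /= /andP[cS uS]].
    by rewrite big_nil set_nil setI0 preimage_set0 measure0.
  rewrite big_cons; have -> : D `&` [set` c :: S] = (D `&` [set c]) `|` (D `&` [set` S]).
    rewrite -setIUr; congr (_ `&` _); apply/seteqP; split => x /=; rewrite inE.
      by case/predU1P => [->|]; [left|right].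
    by move=> [->|->]; rewrite ?eqxx ?orbT.
  rewrite preimage_setU measureU//; last first.
    by rewrite -subset0 => x /= [[_ e1] [_]]; rewrite e1 (negPf cS).
  case: ifPn => [/set_mem cD|/negP cD]; last first.
    rewrite -(IH uS) (_ : D `&` [set c] = set0) ?preimage_set0 ?measure0 ?add0e//.
    by rewrite -subset0 => x [Dx /= xc]; apply: cD; rewrite inE -xc.
  rewrite EFinD -(IH uS) (_ : Y @^-1` (D `&` [set c]) = Y @^-1` [set c]); last first.
    by apply/seteqP; split => x /= => [[]//|->].
  by rewrite /pr -pevE.
rewrite /pev.
rewrite [X in P (_ @^-1` X)](_ : D = (D `&` [set` S]) `|` (D `&` ~` [set` S])); last by rewrite -setIUr setUv setIT.
rewrite preimage_setU measureU//; last first.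
  by rewrite -subset0 => x /= [[_ h1] [_]].
suff h0 : P (Y @^-1` (D `&` ~` [set` S])) = 0%E.
  by transitivity (fine (P (Y @^-1` (D `&` [set` S])) + P (Y @^-1` (D `&` ~` [set` S])))%E) => //; rewrite h0 adde0 H.
apply/eqP; rewrite eq_le measure_ge0 andbT -YS; apply: le_measure; rewrite ?inE//.
by move=> x /= [_ /negP].
Qed.

Lemma sum_pr Y S : disc Y -> uniq S -> supported Y S -> \sum_(c <- S) pr Y c = 1.
Proof.
move=> mY uS YS; have := pr_event [set: C] mY uS YS.
rewrite preimage_setT {1}/pev probability_setT /= => ->.
by apply: eq_bigl => c; rewrite in_setT.
Qed.

Lemma event_dist_le Y Y' S D : disc Y -> disc Y' -> uniq S -> supported Y S -> supported Y' S ->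
  `|pev (Y @^-1` D) - pev (Y' @^-1` D)| <= \sum_(c <- S) `|pr Y c - pr Y' c|.
Proof.
move=> mY mY' uS YS YS'; rewrite !(pr_event _ _ uS)// -sumrB.
apply: (le_trans (ler_norm_sum _ _ _)).
by rewrite [leRHS](bigID (fun c => c \in D))/= lerDl sumr_ge0.
Qed.

Lemma event_seq Y S (Q : pred C) : disc Y -> uniq S ->
  pev (Y @^-1` [set c | (c \in S) && Q c]) = \sum_(c <- S | Q c) pr Y c.
Proof.
move=> mY; elim: S => [_|c S IH /= /andP[cS uS]].
  rewrite big_nil (_ : [set _ | _] = set0); last by rewrite -subset0 => x.
  by rewrite preimage_set0 /pev measure0.
have mD := disc_measurable _ mY.
rewrite big_cons (_ : [set _ | _] = [set x | x = c /\ Q c] `|` [set x | (x \in S) && Q x]); last first.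
  apply/seteqP; split => x /=; rewrite inE.
    by move=> /andP[/predU1P[->|xS] Qx]; [left|right; rewrite xS].
  by move=> [[-> Qc]|/andP[-> ->]]; rewrite ?eqxx ?Qc// orbT.
rewrite preimage_setU /pev measureU//; last first.
  by rewrite -subset0 => x /= [[e1 _]]; rewrite e1 (negPf cS).
rewrite fineD ?fin_num_measure// -/(pev _) -/(pev _) IH//.
case: ifPn => Qc; first by congr (pev (_ @^-1` _) + _); apply/seteqP; split => x /= [].
rewrite (_ : [set x | _] = set0); last by rewrite -subset0 => x /= [_]; apply/negP.
by rewrite preimage_set0 {1}/pev measure0 add0r.
Qed.

Lemma event_seq_dist Y Y' S (Q : pred C) e : disc Y -> disc Y' -> uniq S ->
  (forall D, `|pev (Y @^-1` D) - pev (Y' @^-1` D)| <= e) ->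
  `|\sum_(c <- S | Q c) (pr Y c - pr Y' c)| <= e.
Proof. by move=> mY mY' uS H; rewrite sumrB -!event_seq. Qed.

(** Split the sum by the sign of the difference: each half is a difference of probabilities of one
    event, hence at most [e]. *)
Lemma sum_pr_dist_le Y Y' S e : disc Y -> disc Y' -> uniq S ->
  (forall D, `|pev (Y @^-1` D) - pev (Y' @^-1` D)| <= e) ->
  \sum_(c <- S) `|pr Y c - pr Y' c| <= 2 * e.
Proof.
move=> mY mY' uS H; pose Q c := pr Y' c <= pr Y c.
have h1 := event_seq_dist Q mY mY' uS H.
have h2 := event_seq_dist (predC Q) mY mY' uS H.
rewrite (bigID Q)/= (eq_bigr (fun c => pr Y c - pr Y' c)) => [|c Qc]; last by rewrite ger0_norm ?subr_ge0.
rewrite [X in _ + X](eq_bigr (fun c => - (pr Y c - pr Y' c))) => [|c Qc]; last first.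
  by rewrite ler0_norm// subr_le0 ltW// ltNge.
rewrite sumrN; move: h1 h2; rewrite !ler_norml => /andP[_ h1] /andP[h2 _].
rewrite mulr2n mulrDl mul1r lerD// lerNl; exact: h2.
Qed.

End discrete_law.

Section joint_law.
Context {dT : measure_display} {T : measurableType dT} {R : realType}.
Variable P : probability T R.
Context {d m : nat}.
Notation Z := 'rV[int]_d.
Implicit Types (U : 'I_m -> T -> Z) (s : seq Z).

Definition joint U (t : T) : {ffun 'I_m -> Z} := [ffun j => U j t].

Lemma joint_preimage U (v : {ffun 'I_m -> Z}) :
  joint U @^-1` [set v] = \bigcap_(j in [set: 'I_m]) (U j @^-1` [set v j]).
Proof.
apply/seteqP; split => t /=; first by move=> <- j _; rewrite ffunE.
by move=> H; apply/ffunP => j; rewrite ffunE; exact: H.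
Qed.

Lemma disc_joint U : (forall j, discrete_rv (U j)) -> disc (joint U).
Proof.
move=> mU v; rewrite joint_preimage; apply: fin_bigcap_measurable => // j _; exact: mU.
Qed.

Lemma pr_joint U v : (forall j, discrete_rv (U j)) -> mutually_independent P [set: set Z] U ->
  pr P (joint U) v = \prod_j pr P (U j) (v j).
Proof.
move=> mU iU; rewrite /pr /pev joint_preimage iU//.
rewrite (eq_bigr (fun j => (pr P (U j) (v j))%:E)) => [|j _]; last by rewrite pevE//; exact: mU.
by rewrite prodEFin.
Qed.

(** The type of values is infinite, so the tuples with entries in [s] are listed through functions
    into the indices of [s], which form a finite type. *)
Definition tuples s : seq {ffun 'I_m -> Z} :=
  [seq [ffun j => nth 0 s (u j)] | u : {ffun 'I_m -> 'I_(size s)}].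

Lemma uniq_tuples s : uniq s -> uniq (tuples s).
Proof.
move=> us; rewrite map_inj_uniq ?enum_uniq// => u v /ffunP uv; apply/ffunP => j.
have := uv j; rewrite !ffunE => /eqP; rewrite nth_uniq// => /eqP; exact: val_inj.
Qed.

Lemma supported_joint U s : (forall j, discrete_rv (U j)) ->
  (forall j, supported P (U j) s) -> supported P (joint U) (tuples s).
Proof.
move=> mU sU; apply/eqP; rewrite eq_le measure_ge0 andbT.
pose F (j : 'I_m) := U j @^-1` [set c | c \notin s].
have mF j : measurable (F j) by apply: disc_measurable; exact: mU.
apply: (@le_trans _ _ (P (\big[setU/set0]_(j < m) F j))).
  apply: le_measure; rewrite ?inE//.
  - by apply: disc_measurable; exact: disc_joint.
  - exact: bigsetU_measurable.
  - move=> t /= /negP H; apply: contrapT => nF; apply: H.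
    have Us j : (index (U j t) s < size s)%N.
      rewrite index_mem; apply/negPn/negP => h; apply: nF.
      by rewrite (bigD1 j)//=; left.
    apply/mapP; exists [ffun j => Ordinal (Us j)]; first by rewrite mem_enum.
    by apply/ffunP => j; rewrite !ffunE /= nth_index// -index_mem.
suff [_ ->] : measurable (\big[setU/set0]_(j < m) F j) /\ P (\big[setU/set0]_(j < m) F j) = 0%E by [].
apply: (big_ind (fun A => measurable A /\ P A = 0%E)) => [|A B [mA A0] [mB B0]|j _].
- by split => //; exact: measure0.
- split; first exact: measurableU.
  apply/eqP; rewrite eq_le measure_ge0 andbT; apply: (@le_trans _ _ (P A + P B)%E); first exact: measureU2.
  by rewrite A0 B0 adde0.
- by split => //; exact: sU.
Qed.

Lemma joint_dist_le U U' s (E : set {ffun 'I_m -> Z}) :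
  (forall j, discrete_rv (U j)) -> (forall j, discrete_rv (U' j)) ->
  mutually_independent P [set: set Z] U -> mutually_independent P [set: set Z] U' ->
  uniq s -> (forall j, supported P (U j) s) -> (forall j, supported P (U' j) s) ->
  `|pev P (joint U @^-1` E) - pev P (joint U' @^-1` E)| <=
    \sum_j \sum_(z <- s) `|pr P (U j) z - pr P (U' j) z|.
Proof.
move=> mU mU' iU iU' us sU sU'.
apply: le_trans (event_dist_le E (disc_joint mU) (disc_joint mU') (uniq_tuples us)
  (supported_joint mU sU) (supported_joint mU' sU')) _.
rewrite big_map big_enum/=.
have sumI (F : Z -> R) : \sum_(z <- s) F z = \sum_(i < size s) F (nth 0 s i).
  by rewrite (big_nth 0) big_mkord.
rewrite (eq_bigr (fun u : {ffun 'I_m -> 'I_(size s)} => `|\prod_j pr P (U j) (nth 0 s (u j))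
    - \prod_j pr P (U' j) (nth 0 s (u j))|)); last first.
  move=> u _; rewrite !pr_joint//; congr `|_ - _|; apply: eq_bigr => j _; by rewrite ffunE.
rewrite [leRHS](eq_bigr (fun j => \sum_(i < size s) `|pr P (U j) (nth 0 s i) - pr P (U' j) (nth 0 s i)|)); last first.
  by move=> j _; rewrite sumI.
apply: (prod_dist_le (p := fun j (i : 'I_(size s)) => pr P (U j) (nth 0 s i))
   (q := fun j (i : 'I_(size s)) => pr P (U' j) (nth 0 s i))).
- by move=> *; exact: pr_ge0.
- by move=> *; exact: pr_ge0.
- by move=> j; rewrite -(sumI (pr P (U j))) sum_pr//; exact: mU.
- by move=> j; rewrite -(sumI (pr P (U' j))) sum_pr//; exact: mU'.
Qed.

Variable a : 'I_m -> int.

Definition lincomb (v : 'I_m -> Z) : Z := \sum_j a j *: v j.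

Lemma disc_lincomb U : (forall j, discrete_rv (U j)) -> disc (fun t => lincomb (U^~ t)).
Proof.
move=> mU z.
rewrite (_ : _ @^-1` _ = joint U @^-1` [set v | lincomb v = z]).
  by apply: disc_measurable; exact: disc_joint.
apply/seteqP; split => t /= <-; apply: eq_bigr => j _; by rewrite ffunE.
Qed.

(* Since [sum_j a_j b_j = 1], a shift of [sum_j a_j U_j] by [t] can be distributed over
   the summands as shifts by [b_j t]. *)
Lemma lincomb_shift_le U s (b : 'I_m -> int) (t : Z) D :
  \sum_j a j * b j = 1 ->
  (forall j, discrete_rv (U j)) -> mutually_independent P [set: set Z] U ->
  uniq s -> (forall j, supported P (U j) s) ->
  (forall j, supported P (fun x => U j x + b j *: t) s) ->
  `|pev P ((fun x => lincomb (U^~ x)) @^-1` D) - pev P ((fun x => lincomb (U^~ x) + t) @^-1` D)| <=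
    \sum_j \sum_(z <- s) `|pr P (U j) z - pr P (U j) (z - b j *: t)|.
Proof.
move=> ab mU iU us sU sU'.
pose U' j x := U j x + b j *: t.
have preU' j (A : set Z) : U' j @^-1` A = U j @^-1` [set z | A (z + b j *: t)] by [].
have mU' j : discrete_rv (U' j) by move=> z; rewrite preU'; apply: disc_measurable; exact: mU.
have iU' : mutually_independent P [set: set Z] U'.
  by move=> A _; exact: (iU (fun j => [set z | A j (z + b j *: t)])).
pose E := [set v : {ffun 'I_m -> Z} | D (lincomb v)].
have -> : (fun x => lincomb (U^~ x)) @^-1` D = joint U @^-1` E.
  have H x : lincomb (joint U x) = lincomb (U^~ x).
    by apply: eq_bigr => j _; rewrite ffunE.
  by rewrite /E /preimage; apply/seteqP; split => x /=; rewrite H.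
have -> : (fun x => lincomb (U^~ x) + t) @^-1` D = joint U' @^-1` E.
  have H x : lincomb (joint U' x) = lincomb (U^~ x) + t.
    rewrite /lincomb -[t in RHS]scale1r -ab scaler_suml -big_split/=; apply: eq_bigr => j _.
    by rewrite ffunE scalerDr scalerA.
  by rewrite /E /preimage; apply/seteqP; split => x /=; rewrite H.
apply: le_trans (joint_dist_le E mU mU' iU iU' us sU sU') _.
apply: ler_sum => j _; apply: ler_sum => z _.
suff -> : pr P (U' j) z = pr P (U j) (z - b j *: t) by [].
rewrite /pr preU'; congr (pev P (_ @^-1` _)); apply/seteqP; split => y /=.
  by move=> <-; rewrite addrK.
by move=> ->; rewrite subrK.
Qed.

(** Once the other summands are fixed, at most one value of [U j0] produces [z], since [a j0] is
    nonzero. This value has probability at most [q], and the probabilities of the others add up to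
    at most 1. *)
Lemma pr_lincomb_le U s (j0 : 'I_m) (q : R) z :
  a j0 != 0 -> (forall j, discrete_rv (U j)) -> mutually_independent P [set: set Z] U ->
  uniq s -> (forall j, supported P (U j) s) -> 0 <= q -> (forall v, pr P (U j0) v <= q) ->
  pr P (fun t => lincomb (U^~ t)) z <= q.
Proof.
move=> aj0 mU iU us sU q0 Uq.
pose p j (i : 'I_(size s)) := pr P (U j) (nth 0 s i).
have p0 j i : 0 <= p j i by exact: pr_ge0.
have sump j : \sum_i p j i = 1.
  by rewrite -(sum_pr (mU j) us (sU j)) (big_nth 0) big_mkord.
pose val_ (u : {ffun 'I_m -> 'I_(size s)}) := lincomb (fun j => nth 0 s (u j)).
have -> : pr P (fun t => lincomb (U^~ t)) z = \sum_(u : {ffun 'I_m -> 'I_(size s)} | val_ u == z) \prod_j p j (u j).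
  rewrite /pr (_ : _ @^-1` _ = joint U @^-1` [set v | lincomb v = z]); last first.
    by apply/seteqP; split => t /= <-; apply: eq_bigr => j _; rewrite ffunE.
  rewrite (pr_event _ (disc_joint mU) (uniq_tuples us) (supported_joint mU sU)).
  rewrite big_map big_enum_cond/=; apply: eq_big => [u|u _].
    rewrite /= /val_; apply/idP/eqP => [/set_mem /= <-|h].
      by apply: eq_bigr => j _; rewrite ffunE.
    by rewrite inE /= -h; apply: eq_bigr => j _; rewrite ffunE.
  by rewrite pr_joint//; apply: eq_bigr => j _; rewrite ffunE.
have [/eqP s0|s0] := boolP (size s == 0)%N.
  exfalso; have := sump j0; rewrite big1 => [/eqP|i _]; first by rewrite eq_sym oner_eq0.
  by have := ltn_ord i; move: (nat_of_ord i) => n; rewrite {1}s0.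
have i0 : 'I_(size s) by exists 0%N; rewrite lt0n.
(* [h] forgets the entry [j0] by setting it to a dummy index; on the solutions it is injective. [G]
   puts a point mass at the dummy index, so that the sum over the image is bounded by a full product
   of sums equal to 1. *)
pose h (u : {ffun 'I_m -> 'I_(size s)}) := [ffun j => if j == j0 then i0 else u j].
pose G j i := if j == j0 then (i == i0)%:R else p j i.
have G0 j i : 0 <= G j i by rewrite /G; case: ifP.
have hinj : {in [pred u | val_ u == z] &, injective h}.
  move=> u v /eqP uz /eqP vz /ffunP huv.
  have e j : j != j0 -> u j = v j by move=> jj; have := huv j; rewrite !ffunE (negPf jj).
  apply/ffunP => j; have [->|] := eqVneq j j0; last exact: e.
  have := etrans uz (esym vz); rewrite /val_ /lincomb (bigD1 j0)//= [RHS](bigD1 j0)//=.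
  rewrite [X in _ + X](eq_bigr (fun j => a j *: nth 0 s (v j))) => [|i ij]; last by rewrite e.
  move=> /addIr /rowP av; apply: val_inj; apply/eqP; rewrite -(nth_uniq 0 (ltn_ord _) (ltn_ord _) us).
  by apply/eqP/rowP => l; have := av l; rewrite !mxE; exact: mulfI.
pose A := finset (fun u => val_ u == z).
have hA : {in A &, injective h} by move=> x y; rewrite !inE => xz yz; exact: hinj.
apply: (@le_trans _ _ (q * \sum_(u in A) \prod_j G j (h u j))).
  rewrite mulr_sumr [leRHS](eq_bigl (fun u => val_ u == z)) => [|v]; last by rewrite !inE.
  apply: ler_sum => u _.
  rewrite (bigD1 j0)//= [X in _ <= _ * X](bigD1 j0)//= {1}/G {1}/h ffunE !eqxx mul1r.
  rewrite [X in _ <= _ * X](eq_bigr (fun j => p j (u j))) => [|j jj]; last by rewrite /G ffunE (negPf jj).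
  by apply: ler_wpM2r; [exact: prodr_ge0|exact: Uq].
rewrite -[leRHS]mulr1; apply: ler_wpM2l => //.
rewrite -(big_imset (fun v : {ffun 'I_m -> 'I_(size s)} => \prod_j G j (v j)) hA)/=.
apply: (@le_trans _ _ (\sum_(v : {ffun 'I_m -> 'I_(size s)}) \prod_j G j (v j))).
  rewrite [leRHS](bigID (mem (imset h (mem A))))/= lerDl.
  by apply: sumr_ge0 => v _; exact: prodr_ge0.
rewrite -(bigA_distr_bigA G) big1// => j _; rewrite /G.
have [_|_] := eqVneq j j0; last exact: sump.
by rewrite (bigD1 i0)//= eqxx big1 ?addr0// => i /negPf ->.
Qed.

End joint_law.

(** * Total variation between nearby variables, by averaging over shifts *)

Section window.
Context {dT : measure_display} {T : measurableType dT} {R : realType}.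
Variable P : probability T R.

(** A sum of probabilities is the expectation of the number of events that occur, so a pointwise
    bound on counts suffices. *)
Lemma sum_pev_count (I : eqType) (s : seq I) (A A' : I -> set T) (c : nat) :
  (forall i, measurable (A i)) -> (forall i, measurable (A' i)) ->
  (forall t, (count (fun i => t \in A i) s <= count (fun i => t \in A' i) s + c)%N) ->
  \sum_(i <- s) pev P (A i) <= \sum_(i <- s) pev P (A' i) + c%:R.
Proof.
move=> mA mA' H.
have countE (F : I -> set T) t : (count (fun i => t \in F i) s)%:R = \sum_(i <- s) \1_(F i) t :> R.
  rewrite -sum1_count natr_sum [LHS]big_mkcond/=; apply: eq_bigr => i _.
  by rewrite indicE; case: (_ \in _).
have sumE (F : I -> set T) : (forall i, measurable (F i)) ->
    ((\sum_(i <- s) pev P (F i))%:E = \int[P]_t (count (fun i => t \in F i) s)%:R%:E)%E.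
  move=> mF; rewrite -sumEFin (eq_bigr (fun i => \int[P]_t (\1_(F i) t)%:E)%E) => [|i _]; last first.
    by rewrite integral_indic// setIT; exact/esym/pevE.
  rewrite -ge0_integral_sum//.
  - by apply: eq_integral => t _; rewrite countE sumEFin.
  - by move=> i; apply/measurable_EFinP; exact: measurable_indic.
have mcount (F : I -> set T) : (forall i, measurable (F i)) ->
    measurable_fun [set: T] (fun t => (count (fun i => t \in F i) s)%:R : R).
  move=> mF; rewrite (_ : (fun _ => _) = fun t => \sum_(i <- s) \1_(F i) t).
    by apply: measurable_sum => i; exact: measurable_indic.
  by apply/funext => t; exact: countE.
rewrite -lee_fin EFinD !sumE//.
have -> : c%:R%:E = (\int[P]_t c%:R%:E)%E.
  rewrite integral_cst// -[LHS]mule1; congr (_ * _)%E.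
  exact/esym/probability_setT.
apply: ge0_integral_le_add => //; try exact: mcount.
by move=> t _; rewrite -natrD ler_nat.
Qed.

(** Up to [e], each of the two probabilities is an average over the tau^d shifts in the window. By
    [count_window] the averages differ at most by the boundary fraction of the window, which
    Bernoulli bounds by d * 2C / tau. *)
Lemma window_dist (d : nat) (Z W : T -> 'rV[int]_d) (C tau : nat) (e : R) (D : set 'rV[int]_d) :
  disc Z -> disc W -> (forall t l, `|Z t 0 l - W t 0 l| <= C%:Z) ->
  (2 * C <= tau)%N -> (0 < tau)%N ->
  (forall v, v \in boxseq 0 tau ->
     `|pev P (Z @^-1` D) - pev P ((fun t => Z t + v) @^-1` D)| <= e) ->
  (forall v, v \in boxseq 0 tau ->
     `|pev P (W @^-1` D) - pev P ((fun t => W t + v) @^-1` D)| <= e) ->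
  pev P (Z @^-1` D) <= pev P (W @^-1` D) + 2 * e + d%:R * ((2 * C)%:R / tau%:R).
Proof.
move=> mZ mW ZW Ct t0 Ze We.
have mshift (Y : T -> 'rV[int]_d) v : disc Y -> measurable ((fun t => Y t + v) @^-1` D).
  by move=> mY; apply: (disc_measurable [set y | D (y + v)] mY).
pose c := (tau ^ d - (tau - 2 * C) ^ d)%N.
have H := @sum_pev_count _ (boxseq 0 tau) _ _ c (fun v => mshift Z v mZ) (fun v => mshift W v mW).
have {}H := H (fun t => @count_window d (fun z => z \in D) (Z t) (W t) C tau (ZW t) Ct).
have szb : (size (boxseq (d := d) 0 tau))%:R = tau%:R ^+ d :> R by rewrite size_boxseq natrX.
have tp : 0 < tau%:R :> R by rewrite ltr0n.
have n0 : 0 < tau%:R ^+ d :> R by rewrite exprn_gt0.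
have sumc (x : R) : \sum_(v <- boxseq (d := d) 0 tau) x = tau%:R ^+ d * x.
  by rewrite big_const_seq count_predT iter_addr_0 -[_ *+ _]mulr_natl szb.
have h1 : tau%:R ^+ d * (pev P (Z @^-1` D) - e) <= \sum_(v <- boxseq 0 tau) pev P ((fun t => Z t + v) @^-1` D).
  rewrite -sumc big_seq [leRHS]big_seq; apply: ler_sum => v vb.
  by have := Ze v vb; rewrite ler_norml => /andP[_]; lra.
have h2 : \sum_(v <- boxseq 0 tau) pev P ((fun t => W t + v) @^-1` D) <= tau%:R ^+ d * (pev P (W @^-1` D) + e).
  rewrite -sumc big_seq [leRHS]big_seq; apply: ler_sum => v vb.
  by have := We v vb; rewrite ler_norml => /andP[]; lra.
pose r : R := (2 * C)%:R / tau%:R.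
have r01 : 0 <= r <= 1 by rewrite divr_ge0//= ler_pdivrMr// mul1r ler_nat.
have h3 : c%:R <= tau%:R ^+ d * (d%:R * r).
  have le_exp n : ((tau - 2 * C) ^ n <= tau ^ n)%N.
    by case: n => [//|n]; rewrite leq_exp2r// leq_subr.
  rewrite /c natrB//.
  rewrite !natrX natrB// (_ : tau%:R - (2 * C)%:R = tau%:R * (1 - r)); last first.
    by rewrite /r; field; rewrite gt_eqF.
  have := bernoulli_le d r01; rewrite -(ler_pM2l n0) exprMn; lra.
have : tau%:R ^+ d * (pev P (Z @^-1` D) - e) <= tau%:R ^+ d * (pev P (W @^-1` D) + e + d%:R * r).
  apply: (le_trans h1); apply: (le_trans H); rewrite [leRHS]mulrDr; exact: lerD.
rewrite ler_pM2l// /r; lra.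
Qed.

End window.

(** * Shannon entropy of finitely supported laws *)

Section shannon.
Context {dT : measure_display} {T : measurableType dT} {R : realType} {d : nat}.
Variable P : probability T R.
Variables (W : T -> 'rV[int]_d) (S : seq 'rV[int]_d).
Hypotheses (mW : disc W) (uS : uniq S) (WS : supported P W S).

Lemma pr_unsupported z : z \notin S -> pr P W z = 0.
Proof.
move=> zS; rewrite /pr /pev (_ : P _ = 0%E)//.
have m1 := mW z; have m2 := disc_measurable [set c | c \notin S] mW.
by apply/eqP; rewrite eq_le measure_ge0 andbT -WS; apply: le_measure; rewrite ?inE// => t /= ->.
Qed.

Lemma shannon_entropyE : shannon_entropy P W = (\sum_(z <- S) eta (pr P W z))%:E.
Proof.
rewrite /shannon_entropy.
have E0 z : (0 <= (eta (pr P W z))%:E)%E.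
  rewrite lee_fin /eta; have [->|p0] := eqVneq (pr P W z) 0; first by rewrite mul0r.
  have pp : 0 < pr P W z by rewrite lt_neqAle eq_sym p0 pr_ge0.
  by rewrite mulr_ge0 ?pr_ge0// ln_ge0// invf_ge1// pev_le1//; exact: mW.
transitivity (\esum_(z in [set` S]) (eta (pr P W z))%:E)%E.
  rewrite [RHS]esum_mkcond; apply: eq_esum => z _.
  rewrite -[LHS]/((eta (pr P W z))%:E).
  case: ifPn => // /negP zS.
  by rewrite pr_unsupported ?eta0//; apply/negP => h; apply: zS; rewrite inE.
rewrite esum_fset; [|exact: finite_seq|by move=> *; exact: E0].
by rewrite -fsbig_seq// sumEFin.
Qed.

(** Subtracting d ln k turns the entropy into a Riemann sum of mesh 1/k for [eta] of the rescaled
    masses k^d P(W = z), the discrete counterpart of a density. *)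
Lemma shannon_entropy_scaled k : (0 < k)%N ->
  \sum_(z <- S) eta (pr P W z) - d%:R * ln k%:R =
  \sum_(z <- S) k%:R^-1 ^+ d * eta (k%:R ^+ d * pr P W z).
Proof.
move=> k0; have k1 : 0 < k%:R :> R by rewrite ltr0n.
have kd : 0 < k%:R ^+ d :> R by rewrite exprn_gt0.
rewrite [RHS](eq_bigr (fun z => eta (pr P W z) - pr P W z * ln (k%:R ^+ d))) => [|z _]; last first.
  by rewrite exprVn eta_scale// pr_ge0.
by rewrite sumrB -mulr_suml sum_pr// mul1r lnXn// mulr_natl.
Qed.

End shannon.

(** * Quantization of bounded densities *)

Lemma eventually_seq (I : eqType) (s : seq I) (Q : I -> nat -> Prop) :
  (forall i, i \in s -> exists k0, forall k, (k0 <= k)%N -> Q i k) ->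
  exists k0, forall k, (k0 <= k)%N -> forall i, i \in s -> Q i k.
Proof.
elim: s => [|i s IH] H; first by exists 0%N.
have [k1 H1] := H i (mem_head _ _).
have [|k2 H2] := IH; first by move=> j js; apply: H; rewrite inE js orbT.
exists (maxn k1 k2) => k; rewrite geq_max => /andP[kk1 kk2] j; rewrite inE => /predU1P[->|js].
  exact: H1.
exact: H2.
Qed.

Section discretization.
Context {dT : measure_display} {T : measurableType dT} {R : realType} {d : nat}.
Notation V := 'rV[R]_d.
Notation B := (BorelRd R d).
Variable lam : {measure set B -> \bar R}.
Hypothesis lamE : lebesgue_Rd lam.
Variable P : probability T R.
Implicit Types (X : T -> V) (f : V -> R).

(* An open set is the union of the grid cells, of all scales, that it contains. *)
Lemma borel_rv_coords X : (forall l, measurable_fun [set: T] (fun t => X t 0 l)) -> borel_rv X.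
Proof.
move=> mX; have mcell k z : measurable (X @^-1` cell k z).
  rewrite (_ : _ @^-1` _ = \bigcap_(l in [set: 'I_d])
    ((fun t => k%:R * X t 0 l) @^-1` `[(z 0 l)%:~R, (z 0 l + 1)%:~R[%classic)); last first.
    apply/seteqP; split => t; rewrite /preimage/= cellE /= => H l; first by move=> _; rewrite /= in_itv; exact: H.
    by have := H l I; rewrite /= in_itv.
  apply: fin_bigcap_measurable => // l _; rewrite -[X in measurable X]setTI.
  have mk : measurable_fun [set: T] (fun t => k%:R * X t 0 l) by exact: measurable_funM.
  by apply: mk => //; exact: measurable_itv.
rewrite /borel_rv; apply: (@measurability _ _ _ (BorelRd R d) _ _ (@open V)) => //.
move=> _ [Q oQ <-]; rewrite setTI.
rewrite (_ : X @^-1` Q = \bigcup_k \bigcup_(z in [set z | cell k.+1 z `<=` Q]) (X @^-1` cell k.+1 z)).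
  apply: bigcupT_measurable => k; rewrite bigcup_mkcond.
  apply: countable_bigcupT_measurable => [|z]; first exact: countableP.
  by case: ifP => _ //; exact: mcell.
apply/seteqP; split => t; last by move=> [k _ [z /= zQ zt]]; exact: zQ.
move=> /= Qt; have /nbhs_ballP[e /= e0 eQ] : nbhs (X t) Q by exact: open_nbhs_nbhs.
pose k := Num.truncn (2 / e); have kp : 0 < k.+1%:R :> R by [].
have ke : 2 * k.+1%:R^-1 < e.
  by rewrite ltr_pdivrMr// mulrC -ltr_pdivrMr//; exact: truncnS_gt.
exists k => //; exists (cellv k.+1 (X t)) => // y /= cy; apply: eQ; split => // i l; rewrite (ord1 i).
rewrite /ball /= -(subrKA (corner k.+1 (cellv k.+1 (X t)) 0 l)).
apply: le_lt_trans (ler_normD _ _) _; apply: le_lt_trans ke; rewrite mulrDl mul1r lerD//.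
  exact: cell_corner.
by rewrite distrC; exact: cell_corner.
Qed.

Lemma borel_rv_coord X l : borel_rv X -> measurable_fun [set: T] (fun t => X t 0 l).
Proof. by move=> bX; exact: (measurableT_comp (measurable_coord l) bX). Qed.

Lemma borel_rv_lincomb (m : nat) (c : 'I_m -> R) (X : 'I_m -> T -> V) :
  (forall j, borel_rv (X j)) -> borel_rv (fun t => \sum_j c j *: X j t).
Proof.
move=> bX; apply: borel_rv_coords => l.
rewrite (_ : (fun _ => _) = fun t => \sum_j c j * X j t 0 l); last first.
  by apply/funext => t; rewrite summxE; apply: eq_bigr => j _; rewrite mxE.
apply: measurable_sum => j; apply: measurable_funM => //; exact: borel_rv_coord.
Qed.

Lemma disc_cellv X k : borel_rv X -> disc (fun t => cellv k (X t)).
Proof.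
by move=> bX z; rewrite -[X in measurable X]setTI; exact: (bX measurableT _ (measurable_cell k z)).
Qed.

Lemma density_integrable X f : is_density lam P X f ->
  lam.-integrable [set: B] (fun x : B => (f x)%:E).
Proof.
move=> [mf f0 fP]; apply/integrableP; split; first exact/measurable_EFinP.
under eq_integral do rewrite /= ger0_norm//.
by rewrite -fP// preimage_setT probability_setT ltry.
Qed.

Lemma pr_cellv X f k z : is_density lam P X f ->
  pr P (fun t => cellv k (X t)) z = mass lam k f z.
Proof. by move=> [_ _ fP]; rewrite /pr /pev /mass -fP//; exact: measurable_cell. Qed.

Lemma null_off_cube X f N : is_density lam P X f -> (forall x, ~ cube N x -> f x = 0) ->
  P (X @^-1` (~` cube N)) = 0%E.
Proof.
move=> [mf f0 fP] fN; rewrite fP; last by apply: measurableC; exact: measurable_cube.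
by apply: integral0_eq => x /= /fN ->.
Qed.

Lemma supported_cellv X f N N' k : borel_rv X -> is_density lam P X f ->
  (forall x, ~ cube N x -> f x = 0) -> (N < N')%N -> (0 < k)%N ->
  supported P (fun t => cellv k (X t)) (cells k N').
Proof.
move=> bX fX fN NN k0; apply/eqP; rewrite eq_le measure_ge0 andbT -(null_off_cube fX fN).
apply: le_measure; rewrite ?inE.
- by apply: disc_measurable; exact: disc_cellv.
- rewrite -[X in measurable X]setTI; apply: bX => //; apply: measurableC; exact: measurable_cube.
- move=> t /= h ct; move/negP : h; apply; exact: cellv_mem_cells ct.
Qed.

Lemma supportedS (C C' : countType) (Y : T -> C) (Y' : T -> C') S S' : disc Y -> disc Y' ->
  supported P Y S -> (forall t, Y t \in S -> Y' t \in S') -> supported P Y' S'.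
Proof.
move=> mY mY' YS YY; apply/eqP; rewrite eq_le measure_ge0 andbT -YS.
apply: le_measure; rewrite ?inE; try exact: disc_measurable.
by move=> t /=; apply: contra; exact: YY.
Qed.

Lemma disc_shift (Y : T -> 'rV[int]_d) v : disc Y -> disc (fun t => Y t + v).
Proof. by move=> mY z; apply: (disc_measurable [set y | y + v = z] mY). Qed.

Lemma pr_shift (Y : T -> 'rV[int]_d) v z : pr P (fun t => Y t + v) z = pr P Y (z - v).
Proof.
rewrite /pr; congr (pev P _); apply/seteqP; split => t /=; first by move=> <-; rewrite addrK.
by move=> ->; rewrite subrK.
Qed.

(** One unit of room is for the closed faces of the cube and one for the shift, which moves a cell
    by at most [k] indices, that is, by length 1. *)
Lemma supported_cellv_shift X f N N' k (v : 'rV[int]_d) : borel_rv X -> is_density lam P X f ->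
  (forall x, ~ cube N x -> f x = 0) -> (N.+1 < N')%N -> (0 < k)%N ->
  (forall l, `|v 0 l| <= k%:Z) ->
  supported P (fun t => cellv k (X t) + v) (cells k N').
Proof.
move=> bX fX fN NN k0 vk.
have mU := disc_cellv k bX.
apply: (supportedS mU (disc_shift v mU) (supported_cellv bX fX fN (ltnSn N) k0)) => t.
rewrite !mem_cells => /forallP H; apply/forallP => l; rewrite mxE.
have := H l; have := vk l; move: (cellv k (X t) 0 l) (v 0 l) => x y; nia.
Qed.

Lemma row_bound (v : 'rV[int]_d) : exists k0, forall k, (k0 <= k)%N -> forall l, `|v 0 l| <= k%:Z.
Proof.
exists (\sum_l absz (v 0%R l))%N => k hk l.
have : (absz (v 0%R l) <= k)%N by apply: leq_trans hk; rewrite (bigD1 l)//= leq_addr.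
by move: (v 0 l) => x; lia.
Qed.

Lemma mass_shift_density X f N (v : 'rV[int]_d) : borel_rv X -> is_density lam P X f ->
  forall e : R, 0 < e -> exists k0, forall k, (k0 <= k)%N ->
  \sum_(z <- cells k N) `|mass lam k f z - mass lam k f (z - v)| <= e.
Proof.
move=> bX fX e e0; have [mf _ _] := fX.
apply: mass_shift => //; apply: integrableS (density_integrable fX) => //; exact: measurable_cube.
Qed.

(** A density vanishing off a cube is all that is asked here, so this applies to the sum of the X_j
    directly, without using its product structure. *)
Lemma cellv_shift X f N (v : 'rV[int]_d) : borel_rv X -> is_density lam P X f ->
  (forall x, ~ cube N x -> f x = 0) ->
  forall e : R, 0 < e -> exists k0, forall k, (k0 <= k)%N -> (0 < k)%N -> forall D,
  `|pev P ((fun t => cellv k (X t)) @^-1` D) - pev P ((fun t => cellv k (X t) + v) @^-1` D)| <= e.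
Proof.
move=> bX fX fN e e0.
have [k1 H1] := mass_shift_density N.+2 v bX fX e0.
have [k2 H2] := row_bound v.
exists (maxn k1 k2) => k; rewrite geq_max => /andP[kk1 kk2] k0 D.
have mU := disc_cellv k bX.
apply: le_trans (event_dist_le D mU (disc_shift v mU) (uniq_boxseq _ _)
  (supported_cellv bX fX fN (leqnSn _ : (N < N.+2)%N) k0)
  (supported_cellv_shift bX fX fN (ltnSn _) k0 (H2 k kk2))) _.
rewrite (eq_bigr (fun z => `|mass lam k f z - mass lam k f (z - v)|)); first exact: H1.
by move=> z _; rewrite pr_shift !(pr_cellv k _ fX).
Qed.

Section bounded_case.
Context {m : nat}.
Variables (a : 'I_m -> int) (X : 'I_m -> T -> V) (f : 'I_m -> V -> R) (M : R) (N0 : nat).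
Hypotheses (a1 : (\big[gcdn/0%N]_j `|a j|%N)%N = 1%N).
Hypotheses (bX : forall j, borel_rv (X j))
  (iX : mutually_independent P (@measurable _ (BorelRd R d)) X)
  (fX : forall j, is_density lam P (X j) (f j)) (M0 : 0 < M)
  (fM : forall j x, f j x <= M) (f0 : forall j x, ~ cube N0 x -> f j x = 0).

Let U k j t := cellv k (X j t).
Let S t := \sum_j (a j)%:~R *: X j t.
Let W k t := lincomb a ((U k)^~ t).
Let A := (\sum_j absz (a j))%N.

Let mU k j : discrete_rv (U k j). Proof. exact: disc_cellv. Qed.

Let iU k : mutually_independent P [set: set 'rV[int]_d] (U k).
Proof.
by move=> D _; apply: (iX (B := fun j => cellv k @^-1` D j)) => j; exact: measurable_cellv_preimage.
Qed.

Let mW k : disc (W k). Proof. exact: disc_lincomb. Qed.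

Let bS : borel_rv S. Proof. exact: borel_rv_lincomb. Qed.

Let mZ k : disc (fun t => cellv k (S t)). Proof. exact: disc_cellv. Qed.

Let W_shift (v : 'rV[int]_d) : forall e : R, 0 < e -> exists k0, forall k, (k0 <= k)%N -> (0 < k)%N -> forall D,
  `|pev P (W k @^-1` D) - pev P ((fun t => W k t + v) @^-1` D)| <= e.
Proof.
move=> e e0; have [b ab] := big_gcdn_bezout a; rewrite a1 in ab.
have e1 : 0 < e / m.+1%:R by rewrite divr_gt0.
have [k1 H1] := @eventually_seq _ (enum 'I_m) _
  (fun j _ => mass_shift_density N0.+2 (b j *: v) (bX j) (fX j) e1).
have [k2 H2] := @eventually_seq _ (enum 'I_m) _ (fun j _ => row_bound (b j *: v)).
exists (maxn k1 k2) => k; rewrite geq_max => /andP[kk1 kk2] k0 D.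
apply: le_trans (lincomb_shift_le D ab (mU k) (@iU k) (uniq_boxseq _ _)
  (fun j => supported_cellv (bX j) (fX j) (@f0 j) (leqnSn _ : (N0 < N0.+2)%N) k0)
  (fun j => supported_cellv_shift (bX j) (fX j) (@f0 j) (ltnSn _) k0 (H2 k kk2 j (mem_enum _ _)))) _.
apply: (@le_trans _ _ (\sum_(j < m) e / m.+1%:R)).
  apply: ler_sum => j _.
  rewrite (eq_bigr (fun z => `|mass lam k (f j) z - mass lam k (f j) (z - b j *: v)|)).
    exact: H1 (mem_enum _ _).
  by move=> z _; rewrite !(pr_cellv k _ (fX j)).
rewrite sumr_const card_ord -[_ *+ _]mulr_natl mulrCA ger_pMr// ler_pdivrMr// mul1r.
by rewrite ler_nat.
Qed.

(** The rounding error of each X_j is at most 1 and is multiplied by |a_j|, which gives [A] in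
    total; rounding the sum itself adds 1. *)
Let Z_W k t l : `|cellv k (S t) 0 l - W k t 0 l| <= A.+1%:Z.
Proof.
rewrite mxE; set F := Num.floor _; set w := W k t 0 l.
have /andP[F1 F2] : F%:~R <= k%:R * S t 0 l < (F + 1)%:~R := floor_itv _.
have kS : `|k%:R * S t 0 l - w%:~R| <= A%:R.
  have -> : k%:R * S t 0 l - w%:~R = \sum_j (a j)%:~R * (k%:R * X j t 0 l - (Num.floor (k%:R * X j t 0 l))%:~R).
    rewrite /S /w /W /lincomb !summxE rmorph_sum mulr_sumr -sumrB; apply: eq_bigr => j _ /=.
    rewrite !mxE rmorphM/=; ring.
  rewrite /A natr_sum; apply: le_trans (ler_norm_sum _ _ _) _; apply: ler_sum => j _.
  rewrite normrM -intr_norm natr_absz; apply: ler_piMr; first by rewrite ler0z.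
  set y := k%:R * _; have /andP[y1 y2] := floor_itv y.
  by rewrite intrD in y2; rewrite ler_norml; apply/andP; split; lra.
rewrite -(ler_int R) intr_norm intrB; move: kS; rewrite intrD in F2.
rewrite -[(Posz _)%:~R]/(A.+1%:R : R) -natr1 !ler_norml => /andP[h1 h2].
by apply/andP; split; lra.
Qed.

Let supported_W k N1 : (A * N0.+1 < N1)%N -> (0 < k)%N -> supported P (W k) (cells k N1).
Proof.
move=> AN k0.
have sJ := supported_joint (mU k) (fun j => supported_cellv (bX j) (fX j) (@f0 j) (ltnSn N0) k0).
apply: (supportedS (disc_joint (mU k)) (mW k) sJ) => t /mapP[u _ /ffunP ju].
have Uc j : U k j t \in cells k N0.+1 by have := ju j; rewrite !ffunE => ->; exact: mem_nth.
rewrite mem_cells; apply/forallP => l.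
have : `|W k t 0 l| <= (A * (k * N0.+1))%N%:Z.
  rewrite /W /lincomb summxE; apply: le_trans (ler_norm_sum _ _ _) _.
  rewrite /A big_distrl/= -natz natr_sum.
  apply: ler_sum => j _; rewrite mxE normrM natrM !natz abszE.
  apply: ler_wpM2l => //; have := Uc j; rewrite mem_cells => /forallP/(_ l).
  by move: (U k j t 0 l) => x; lia.
have : (A * (k * N0.+1) < k * N1)%N by rewrite mulnCA ltn_pmul2l.
by move: (W k t 0 l) => x; lia.
Qed.

Let pr_W_le k z : (0 < k)%N -> k%:R ^+ d * pr P (W k) z <= M.
Proof.
move=> k0; have k1 : 0 < k%:R :> R by rewrite ltr0n.
have kd : 0 < k%:R ^+ d :> R by rewrite exprn_gt0.
have [j0 aj0] : exists j, a j != 0.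
  apply/existsP; rewrite -[X in is_true X]negbK negb_exists; apply/negP => /forallP aall.
  have : (\big[gcdn/0%N]_j `|a j|%N)%N = 0%N.
    apply: (big_ind (fun n => n = 0%N)) => // [x y -> ->//|j _].
    by have := aall j; rewrite negbK => /eqP ->.
  by rewrite a1.
suff : pr P (W k) z <= M / k%:R ^+ d by rewrite ler_pdivlMr// mulrC.
apply: (pr_lincomb_le (s := cells k N0.+1) z aj0 (mU k) (@iU k)).
- exact: uniq_boxseq.
- by move=> j; apply: supported_cellv (bX j) (fX j) (@f0 j) (ltnSn N0) k0.
- by rewrite divr_ge0// ltW.
- move=> v; rewrite (pr_cellv k v (fX j0)) ler_pdivlMr// mulrC.
  have [mf fge _] := fX j0.
  by apply: (mass_le lamE) => // x; rewrite fge fM.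
Qed.

(** If floor(kS) = z, then by [Z_W] the variable [W] lies in a cube of side 2(A+1)+1 around z, each
    point of which has mass at most M k^-d. *)
Let M' : R := (A.+1.*2.+1 ^ d)%:R * M.

Let M_M' : M <= M'.
Proof. by rewrite /M' ler_peMl ?(ltW M0)// ler1n expn_gt0. Qed.

Let pr_Z_le k z : (0 < k)%N -> k%:R ^+ d * pr P (fun t => cellv k (S t)) z <= M'.
Proof.
move=> k0; have k1 : 0 < k%:R :> R by rewrite ltr0n.
have kd : 0 < k%:R ^+ d :> R by rewrite exprn_gt0.
pose s := [seq z + v | v <- boxseq (d := d) (- A.+1%:Z) A.+1.*2.+1].
have us : uniq s by rewrite map_inj_uniq ?uniq_boxseq//; exact: addrI.
apply: (@le_trans _ _ (k%:R ^+ d * \sum_(y <- s) pr P (W k) y)).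
  rewrite ler_pM2l// -(event_seq P xpredT (mW k) us) /pr -lee_fin -!pevE.
  - apply: le_measure; rewrite ?inE; [exact: mZ|exact: disc_measurable|].
    move=> t /= Zt; rewrite andbT; apply/mapP; exists (W k t - z); last by rewrite addrC subrK.
    rewrite mem_boxseq; apply/forallP => l; have := Z_W k t l; rewrite Zt !mxE.
    by move: (W k t 0 l) (z 0 l) => x y; lia.
  - exact: disc_measurable.
  - exact: mZ.
rewrite mulr_sumr; apply: (@le_trans _ _ (\sum_(y <- s) M)).
  by apply: ler_sum => y _; exact: pr_W_le.
rewrite big_const_seq count_predT iter_addr_0 -[_ *+ _]mulr_natl /M' ler_wpM2r ?(ltW M0)//.
have -> // : size s = (A.+1.*2.+1 ^ d)%N by rewrite /s size_map size_boxseq.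
Qed.

Variables (g : V -> R) (NS : nat).
Hypotheses (gS : is_density lam P S g) (gN : forall x, ~ cube NS x -> g x = 0).

Let Z_W_dist : forall e : R, 0 < e -> exists k0, forall k, (k0 <= k)%N -> (0 < k)%N -> forall D,
  `|pev P (W k @^-1` D) - pev P ((fun t => cellv k (S t)) @^-1` D)| <= e.
Proof.
move=> e e0; pose c : R := d%:R * (2 * A.+1)%:R; have c0 : 0 <= c by rewrite mulr_ge0.
(* The window is so large that its boundary costs at most e / 2, and large enough for
   [count_window]. It does not depend on [k], so finitely many shifts are involved and a common
   threshold exists; they contribute 2 * (e / 4). *)
pose tau := ((Num.truncn (c / (e / 2))).+1 + 2 * A.+1)%N.
have tau0 : (0 < tau)%N by [].
have ctau : d%:R * ((2 * A.+1)%:R / tau%:R) <= e / 2.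
  rewrite mulrA -/c ler_pdivrMr ?ltr0n// mulrC -ler_pdivrMr ?divr_gt0//.
  apply: (le_trans (ltW (truncnS_gt _))); by rewrite ler_nat leq_addr.
have e4 : 0 < e / 4 by rewrite divr_gt0.
have [k1 H1] := @eventually_seq _ (boxseq (d := d) 0 tau) _ (fun v _ => W_shift v e4).
have [k2 H2] := @eventually_seq _ (boxseq (d := d) 0 tau) _ (fun v _ => cellv_shift v bS gS gN e4).
exists (maxn k1 k2) => k; rewrite geq_max => /andP[kk1 kk2] k0 D.
have Ct : (2 * A.+1 <= tau)%N by rewrite leq_addl.
have h1 := window_dist (mZ k) (mW k) (Z_W k) Ct tau0
  (fun v vb => H2 k kk2 v vb k0 D) (fun v vb => H1 k kk1 v vb k0 D).
have WZ t l : `|W k t 0 l - cellv k (S t) 0 l| <= A.+1%:Z by rewrite distrC.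
have h2 := window_dist (mW k) (mZ k) WZ Ct tau0
  (fun v vb => H1 k kk1 v vb k0 D) (fun v vb => H2 k kk2 v vb k0 D).
by rewrite ler_norml; apply/andP; split; lra.
Qed.

(** The masses of [W] are replaced by those of floor(kS), whose sum is a Riemann sum for the entropy
    of [S]. The version [h] of the density is [g] cut at [M'], which the point masses of floor(kS)
    show to be an almost sure bound; that h is at most g is recorded for the comparison with the
    density before conditioning. *)
Lemma bounded_case : exists2 h : V -> R,
  [/\ is_density lam P S h, (forall x, 0 <= h x) & (forall x, h x <= g x)] &
  forall e : R, 0 < e -> exists k0, forall k, (k0 <= k)%N -> (0 < k)%N ->
    (shannon_entropy P (W k) < +oo)%E /\
    `|fine (shannon_entropy P (W k)) - d%:R * ln k%:R - fine (\int[lam]_x (eta (h x))%:E)| <= e.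
Proof.
have [mg g0 gP] := gS; have M'0 : 0 < M' by exact: lt_le_trans M_M'.
pose h x := Num.min (g x) M'.
have mh : measurable_fun [set: B] (h : B -> R) by exact: measurable_minr.
have h0 x : 0 <= h x by rewrite le_min g0 ltW.
have hN x : ~ cube NS x -> h x = 0 by move=> /gN; rewrite /h => ->; apply: min_idPl; exact: ltW.
have pos0 : (\int[lam]_x (Num.max (g x - M') 0)%:E = 0)%E.
  apply: (bounded_by_mass lamE mg g0 gN (ltW M'0) (density_integrable gS)) => k z k0.
  by rewrite -(pr_cellv k z gS); exact: pr_Z_le.
have hS : is_density lam P S h.
  split => // D mD; rewrite gP//; apply/esym.
  by apply: (integral_min_pos_part (f := fun=> M')) => // x; exact: ltW.
exists h; first by split => // x; rewrite ge_min lexx.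
move=> e e0; pose N1 := (maxn (A * N0.+1) NS).+1.
have AN1 : (A * N0.+1 < N1)%N by rewrite ltnS leq_maxl.
have SN1 : (NS < N1)%N by rewrite ltnS leq_maxr.
have e2 : 0 < e / 2 by rewrite divr_gt0.
have hM x : 0 <= h x <= M' by rewrite h0 ge_min lexx orbT.
have [k1 H1] := riemann_eta lamE mh hM M'0 SN1 hN e2.
pose K : R := (N1.*2)%:R ^+ d; have K0 : 0 <= K by rewrite exprn_ge0.
pose r := e / 4 / (K + 1); have r0 : 0 < r by rewrite !divr_gt0// ltr_wpDl.
have [C C0 HC] := eta_modulus M'0 r0.
(* Passing from events to the L1 distance doubles [del] ([sum_pr_dist_le]), so this part costs at
   most e / 4, as does the part with [r]. The Riemann sum takes the remaining e / 2. *)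
pose del := e / 8 / (C + 1); have del0 : 0 < del by rewrite !divr_gt0// ltr_wpDl.
have [k2 H2] := Z_W_dist del0.
exists (maxn k1 k2) => k; rewrite geq_max => /andP[kk1 kk2] k0.
have kp : 0 < k%:R :> R by rewrite ltr0n.
have kd : 0 < k%:R ^+ d :> R by rewrite exprn_gt0.
have uc : uniq (cells (d := d) k N1) by exact: uniq_boxseq.
have WN := supported_W AN1 k0.
rewrite (shannon_entropyE (mW k) uc WN); split; first exact: ltry.
rewrite [fine _]/= (shannon_entropy_scaled (mW k) uc WN k0).
rewrite -(subrKA (\sum_(z <- cells k N1) k%:R^-1 ^+ d * eta (k%:R ^+ d * mass lam k h z))).
rewrite (le_trans (ler_normD _ _))// [leRHS]splitr lerD//; last exact: H1.
rewrite -sumrB; apply: le_trans (ler_norm_sum _ _ _) _.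
apply: (@le_trans _ _ (\sum_(z <- cells k N1)
    (k%:R^-1 ^+ d * r + C * `|pr P (W k) z - pr P (fun t => cellv k (S t)) z|))).
  apply: ler_sum => z _; rewrite -(pr_cellv k z hS) -mulrBr normrM.
  have kd' : 0 <= k%:R^-1 ^+ d :> R by rewrite exprn_ge0 ?invr_ge0.
  rewrite (ger0_norm kd').
  set u := k%:R ^+ d * _; set v := k%:R ^+ d * _.
  have uM : 0 <= u <= M' by rewrite mulr_ge0 ?pr_ge0//= ?(ltW kd)//; exact: le_trans (pr_W_le z k0) M_M'.
  have vM : 0 <= v <= M' by rewrite mulr_ge0 ?pr_ge0//= ?(ltW kd)//; exact: pr_Z_le.
  apply: (le_trans (ler_wpM2l kd' (HC u v uM vM))).
  rewrite mulrDr lerD2l /u /v -mulrBr normrM (ger0_norm (ltW kd)) mulrCA ler_wpM2l//.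
  by rewrite mulrA exprVn mulVf ?gt_eqF// mul1r.
rewrite big_split/= -[X in _ + X]mulr_sumr.
have h1 : \sum_(z <- cells (d := d) k N1) k%:R^-1 ^+ d * r <= e / 4.
  rewrite big_const_seq count_predT size_cells iter_addr_0 -[_ *+ _]mulr_natl mulrA.
  have -> : ((k * N1).*2 ^ d)%:R * k%:R^-1 ^+ d = K :> R.
    rewrite /K -muln2 -mulnA muln2 natrX natrM exprMn exprVn.
    by field; rewrite ?expf_neq0 ?gt_eqF.
  by rewrite /r mulrCA ger_pMr ?divr_gt0// ler_pdivrMr ?ltr_wpDl// mul1r lerDl.
have h2 : C * \sum_(z <- cells k N1) `|pr P (W k) z - pr P (fun t => cellv k (S t)) z| <= e / 4.
  apply: (@le_trans _ _ (C * (2 * del))).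
    by rewrite ler_wpM2l//; apply: sum_pr_dist_le => // D; exact: H2.
  have : C * del <= e / 8.
    by rewrite /del mulrCA ger_pMr ?divr_gt0// ler_pdivrMr ?ltr_wpDl// mul1r lerDl.
  lra.
lra.
Qed.

End bounded_case.
End discretization.

(** * Conditioning on a bounded event *)

Section radon_nikodym_Rd.
Context {R : realType} {d : nat}.
Notation V := 'rV[R]_d.
Notation B := (BorelRd R d).

Section lebesgue_sigma_finite.
Variable lam : {measure set B -> \bar R}.

(* A copy of [lam] that carries the proof of [lebesgue_Rd lam], so that the sigma-finiteness
   required by the Radon-Nikodym theorem can be declared as an instance. *)
Definition lebesgue_sf (_ : lebesgue_Rd lam) : set B -> \bar R := lam.

Hypothesis lamE : lebesgue_Rd lam.

HB.instance Definition _ := Measure.on (lebesgue_sf lamE).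

Let sigma_finite_lebesgue_sf : sigma_finite [set: B] (lebesgue_sf lamE).
Proof.
exists (fun N : nat => cube N) => [|N]; last by split; [exact: measurable_cube|exact: lam_cube_lty].
apply/seteqP; split => // x _; pose S := \sum_l `|x 0 l|.
exists (Num.truncn S).+1 => // l; rewrite -ler_norml.
apply: (@le_trans _ _ S); first by rewrite /S (bigD1 l)//= lerDl sumr_ge0.
exact: ltW (truncnS_gt _).
Qed.

HB.instance Definition _ := Measure_isSigmaFinite.Build _ _ _ (lebesgue_sf lamE)
  sigma_finite_lebesgue_sf.

End lebesgue_sigma_finite.

Section law.
Context {dT : measure_display} {T : measurableType dT}.
Variables (P : probability T R) (X : T -> V).

(** The proof that [X] is Borel is an argument because the measure structure declared on [law]
    depends on it. *)
Definition law (_ : borel_rv X) : set B -> \bar R := fun D => P (X @^-1` D).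

Hypothesis bX : borel_rv X.

Let mpre (D : set B) : measurable D -> measurable (X @^-1` D).
Proof. by move=> mD; rewrite -[X in measurable X]setTI; exact: bX. Qed.

Let law0 : law bX set0 = 0%E. Proof. by rewrite /law preimage_set0 measure0. Qed.

Let law_ge0 D : (0 <= law bX D)%E. Proof. exact: measure_ge0. Qed.

Let law_sigma_additive : semi_sigma_additive (law bX).
Proof.
move=> F mF tF mUF; rewrite /law preimage_bigcup.
apply: measure_semi_sigma_additive.
- by move=> n; exact: mpre.
- apply/trivIsetP => /= i j _ _ ij; rewrite -preimage_setI.
  by move/trivIsetP : tF => /(_ _ _ _ _ ij) ->//; rewrite preimage_set0.
- by rewrite -preimage_bigcup; exact: mpre.
Qed.

HB.instance Definition _ := isMeasure.Build _ _ _ (law bX) law0 law_ge0 law_sigma_additive.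

Let law1 : law bX [set: B] = 1%E.
Proof. by rewrite /law preimage_setT probability_setT. Qed.

HB.instance Definition _ := Measure_isProbability.Build _ _ _ (law bX) law1.

Lemma density_exists (lam : {measure set B -> \bar R}) : lebesgue_Rd lam ->
  abs_continuous_rv lam P X -> exists f, is_density lam P X f.
Proof.
move=> lamE acX.
have [|f [f0 ffin fint fE]] :=
  @radon_nikodym_sigma_finite _ B R (lebesgue_sf lamE) (law bX).
  apply/null_content_dominatesP => D mD D0; exact: acX.
exists (fun x => fine (f x)); split.
- by apply: measurableT_comp; [exact: fine_measurable|exact: measurable_int fint].
- by move=> x; exact: fine_ge0.
- move=> D mD; rewrite -[LHS]/(law bX D) fE//.
  by apply: eq_integral => x _; rewrite fineK.
Qed.

End law.
End radon_nikodym_Rd.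

Section conditioning.
Context {dT : measure_display} {T : measurableType dT} {R : realType}.
Variable P : probability T R.

(** For an event of probability 0 the normalization falls back on [P], so the statements about
    [condP] assume positive probability. *)
Definition condP (A : set T) (mA : measurable A) : probability T R := mnormalize (mrestr P mA) P.

Lemma condPE A (mA : measurable A) D : 0 < pev P A -> measurable D ->
  condP mA D = ((pev P A)^-1 * pev P (D `&` A))%:E.
Proof.
move=> A0 mD; have PA : P A = (pev P A)%:E by exact: pevE.
(* [ev] abstracts the total mass of the restriction, on which the definition of the normalization
   branches, so that its value can be substituted. *)
suff H (ev : \bar R) : ev = (pev P A)%:E ->
    (if (ev == 0%E) || (ev == +oo%E) then fun U => P U
     else fun U => (P (U `&` A) * ((fine ev)^-1)%:E)%E) D = ((pev P A)^-1 * pev P (D `&` A))%:E.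
  by apply: (H (P (setT `&` A))); rewrite setTI.
move=> ->; rewrite eqe gt_eqF//= (pevE P (measurableI _ _ mD mA)) -EFinM mulrC//.
Qed.

Lemma pev_condP A (mA : measurable A) D : 0 < pev P A -> measurable D ->
  pev (condP mA) D = (pev P A)^-1 * pev P (D `&` A).
Proof. by move=> A0 mD; rewrite {1}/pev condPE. Qed.

Lemma le_pev A D : measurable A -> measurable D -> A `<=` D -> pev P A <= pev P D.
Proof. by move=> mA mD AD; rewrite -lee_fin -!pevE//; apply: le_measure; rewrite ?inE. Qed.

End conditioning.

Section truncation.
Context {dT : measure_display} {T : measurableType dT} {R : realType} {d m : nat}.
Notation V := 'rV[R]_d.
Notation B := (BorelRd R d).
Variable lam : {measure set B -> \bar R}.
Hypothesis lamE : lebesgue_Rd lam.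
Variable P : probability T R.
Variables (X : 'I_m -> T -> V) (f : 'I_m -> V -> R).
Hypotheses (bX : forall j, borel_rv (X j))
  (iX : mutually_independent P (@measurable _ (BorelRd R d)) X)
  (fX : forall j, is_density lam P (X j) (f j)).

Definition trunc_set (N : nat) (j : 'I_m) : set B := cube N `&` [set x | f j x <= N%:R].

Lemma measurable_trunc_set N j : measurable (trunc_set N j).
Proof.
apply: measurableI; first exact: measurable_cube.
have [mf _ _] := fX j; rewrite -[X in measurable X]setTI.
rewrite (_ : [set x | _] = f j @^-1` `]-oo, N%:R]); first exact: mf.
by apply/seteqP; split => x /=; rewrite in_itv.
Qed.

Let mpre j (D : set B) : measurable D -> measurable (X j @^-1` D).
Proof. by move=> mD; rewrite -[X in measurable X]setTI; exact: bX. Qed.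

Definition trunc_event N : set T := \bigcap_(j in [set: 'I_m]) (X j @^-1` trunc_set N j).

Lemma measurable_trunc_event N : measurable (trunc_event N).
Proof.
by apply: fin_bigcap_measurable => // j _; apply: mpre; exact: measurable_trunc_set.
Qed.

Lemma trunc_event_large (e : R) : 0 < e -> exists N, 1 - e <= pev P (trunc_event N).
Proof.
move=> e0; have mC N : measurable (~` trunc_event N).
  by apply: measurableC; exact: measurable_trunc_event.
have [|||N HN] := @measure_decr_small _ _ _ P setT (fun N => ~` trunc_event N) e measurableT _ mC _ _ e0.
- by rewrite [X in (X < _)%E]probability_setT ltry.
- move=> n p np; apply: subsetC => t Ht j _; have [ct ft] := Ht j I.
  by split; [exact: cube_subset ct|apply: (le_trans ft); rewrite ler_nat].
- rewrite -subset0 => t Ht.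
  pose F j := `|f j (X j t)| + \sum_l `|X j t 0 l|; pose S := \sum_j F j.
  have F0 j : 0 <= F j by rewrite addr_ge0// sumr_ge0.
  have FS j : F j <= S by rewrite /S (bigD1 j)//= lerDl sumr_ge0.
  apply: (Ht (Num.truncn S).+1 I) => j _.
  have Sn : S <= (Num.truncn S).+1%:R by exact: ltW (truncnS_gt _).
  split => [l|] /=.
    rewrite -ler_norml; apply: le_trans (le_trans (FS j) Sn).
    by rewrite /F (bigD1 l)//= addrCA lerDl addr_ge0// sumr_ge0.
  apply: (le_trans (ler_norm _)); apply: le_trans (le_trans (FS j) Sn).
  by rewrite lerDl sumr_ge0.
exists N; rewrite setTI in HN.
have mE := measurable_trunc_event N.
have : (P (~` trunc_event N) = 1 - P (trunc_event N))%E by exact: probability_setC.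
move=> h; move: HN; rewrite [X in (X <= _)%E](h : _ = _) (pevE P mE) -EFinB lee_fin; lra.
Qed.

Section fixed_level.
Variable N : nat.
Let E := trunc_event N.
Let mE : measurable E := measurable_trunc_event N.
Let p := pev P E.
Hypothesis p0 : 0 < p.
Let Q := condP P mE.
Let q j := pev P (X j @^-1` trunc_set N j).

Let mK j := measurable_trunc_set N j.

Let prod_event (D : 'I_m -> set B) : (forall j, measurable (D j)) ->
  pev P (\bigcap_(j in [set: 'I_m]) (X j @^-1` D j)) = \prod_j pev P (X j @^-1` D j).
Proof.
move=> mD; rewrite {1}/pev iX//.
rewrite (eq_bigr (fun j => (pev P (X j @^-1` D j))%:E)) => [|j _]; first by rewrite prodEFin.
by rewrite pevE//; exact: mpre.
Qed.

Let pE : p = \prod_j q j. Proof. by rewrite /p /E /trunc_event prod_event. Qed.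

Let q0 j : 0 < q j.
Proof.
rewrite lt_neqAle pev_ge0 andbT eq_sym; apply/eqP => qj; move: p0.
by rewrite pE (bigD1 j)//= qj mul0r ltxx.
Qed.

Let pq j : p <= q j.
Proof. by apply: le_pev => //; [apply: mpre|move=> t Ht; exact: Ht]. Qed.

(** By independence the truncations of the other variables contribute the same factors to numerator
    and denominator, so they cancel. This is also what keeps the variables independent under [Q]. *)
Let Q_marginal j (D : set B) : measurable D ->
  pev Q (X j @^-1` D) = (q j)^-1 * pev P (X j @^-1` (D `&` trunc_set N j)).
Proof.
move=> mD; rewrite pev_condP//; last exact: mpre.
have -> : X j @^-1` D `&` E = \bigcap_(i in [set: 'I_m]) (X i @^-1` ((if i == j then D else setT) `&` trunc_set N i)).
  apply/seteqP; split => t.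
    by move=> [Dt Et] i _; split; [case: eqP => [->//|_]; exact: I|exact: Et].
  move=> H; split; last by move=> i _; have [_] := H i I.
  by have [] := H j I; rewrite eqxx.
rewrite prod_event; last by move=> i; apply: measurableI => //; case: ifP.
rewrite -/p pE (bigD1 j)//= [X in _ * X](bigD1 j)//= eqxx.
rewrite [X in _ * (_ * X)](eq_bigr q) => [|i ij]; last by rewrite (negPf ij) setTI.
have Pi0 : 0 < \prod_(i < m | i != j) q i by apply: prodr_gt0.
by field; rewrite !gt_eqF.
Qed.

Lemma condP_independent : mutually_independent Q (@measurable _ (BorelRd R d)) X.
Proof.
move=> D mD; have mI : measurable (\bigcap_(j in [set: 'I_m]) (X j @^-1` D j)).
  by apply: fin_bigcap_measurable => // j _; exact: mpre.
rewrite (pevE Q mI) (eq_bigr (fun j => (pev Q (X j @^-1` D j))%:E)) => [|j _]; last first.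
  by rewrite pevE//; exact: mpre.
rewrite prodEFin; congr EFin; rewrite pev_condP//.
have -> : \bigcap_(j in [set: 'I_m]) (X j @^-1` D j) `&` E =
    \bigcap_(j in [set: 'I_m]) (X j @^-1` (D j `&` trunc_set N j)).
  apply/seteqP; split => t; first by move=> [Dt Et] i _; split; [exact: Dt|exact: Et].
  by move=> H; split => i _; have [] := H i I.
rewrite prod_event; last by move=> i; exact: measurableI.
rewrite -/p pE -prodfV -big_split/=; apply: eq_bigr => j _.
by rewrite Q_marginal.
Qed.

Definition trunc_density j x := (q j)^-1 * (\1_(trunc_set N j) x * f j x).

Lemma condP_density j : is_density lam Q (X j) (trunc_density j).
Proof.
have [mf f0 fP] := fX j.
have m1 : measurable_fun [set: B] ((fun x => \1_(trunc_set N j) x * f j x) : B -> R).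
  by apply: measurable_funM => //; exact: measurable_indic.
have n1 x : 0 <= \1_(trunc_set N j) x * f j x by rewrite mulr_ge0// indicE; case: (_ \in _).
split.
- exact: measurable_funM.
- by move=> x; rewrite mulr_ge0// invr_ge0 ltW.
- move=> D mD; rewrite pevE ?Q_marginal//; last exact: mpre.
  rewrite /trunc_density; under eq_integral do rewrite EFinM.
  rewrite ge0_integralZl_EFin//; last 3 first.
  - by move=> x _; rewrite lee_fin.
  - by apply/measurable_EFinP; exact: measurable_funTS.
  - by rewrite invr_ge0 ltW.
  rewrite EFinM -pevE; last by apply: mpre; exact: measurableI.
  congr (_ * _)%E; rewrite fP; last exact: measurableI.
  rewrite [LHS]integral_mkcond [RHS]integral_mkcond; apply: eq_integral => x _; rewrite !patchE in_setI indicE.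
  by case: (x \in D); case: (x \in trunc_set N j); rewrite /= ?mul1r ?mul0r.
Qed.

Lemma trunc_density_le j x : trunc_density j x <= N%:R / p + 1.
Proof.
have [mf f0 fP] := fX j; rewrite /trunc_density indicE.
(* On the truncation set [f j] is at most N, and 1 / q j is at most 1 / p. The extra 1 only makes
   the bound positive. *)
apply: (@le_trans _ _ (N%:R / p)); last by rewrite lerDl.
have [/set_mem [_ /= h]|_] := boolP (x \in _); last by rewrite mul0r mulr0 divr_ge0// ltW.
rewrite mul1r mulrC; apply: (@le_trans _ _ (N%:R * (q j)^-1)).
  by rewrite ler_wpM2r// invr_ge0 ltW.
by rewrite ler_wpM2l// lef_pV2 ?posrE.
Qed.

Lemma trunc_density_off_cube j x : ~ cube N x -> trunc_density j x = 0.
Proof.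
by move=> nc; rewrite /trunc_density indicE memNset ?mul0r ?mulr0// => -[].
Qed.

Variables (a : 'I_m -> int) (g : V -> R).
Let S t := \sum_j (a j)%:~R *: X j t.
Let A := (\sum_j absz (a j))%N.
Hypothesis gS : is_density lam P S g.

Let bS : borel_rv S. Proof. exact: borel_rv_lincomb. Qed.

Let mS (D : set B) : measurable D -> measurable (S @^-1` D).
Proof. by move=> mD; rewrite -[X in measurable X]setTI; exact: bS. Qed.

Let E_cube : E `<=` S @^-1` cube (A * N).
Proof.
move=> t Et l; rewrite -ler_norml /S summxE natrM /A natr_sum mulr_suml.
apply: le_trans (ler_norm_sum _ _ _) _; apply: ler_sum => j _.
rewrite mxE normrM -intr_norm natr_absz; apply: ler_wpM2l; first by rewrite ler0z.
by have [/(_ l)] := Et j I; rewrite -ler_norml.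
Qed.

(** Since [Q] is at most P / p, the sum stays absolutely continuous and its new density is at most g
    / p almost everywhere. On the event the sum is confined to a cube, so the density can be taken
    to vanish outside. *)
Lemma condP_density_lincomb : exists2 h : V -> R, is_density lam Q S h &
  (forall x, h x <= p^-1 * g x) /\ (forall x, ~ cube (A * N) x -> h x = 0).
Proof.
have [mg g0 gP] := gS.
have [|h0 [mh h00 hP]] := density_exists (P := Q) bS lamE.
  move=> D mD D0; rewrite condPE//; last exact: mS.
  suff PD : pev P (S @^-1` D `&` E) = 0 by rewrite PD mulr0.
  have PS : P (S @^-1` D) = 0%E.
    by rewrite gP// null_set_integral//; apply/measurable_EFinP; exact: measurable_funTS.
  have PSE : pev P (S @^-1` D `&` E) <= pev P (S @^-1` D).
    by apply: le_pev; [apply: measurableI => //|exact: mS|exact: subIsetl]; exact: mS.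
  apply/eqP; rewrite eq_le; apply/andP; split; last exact: pev_ge0.
  by apply: (le_trans PSE); rewrite /pev PS.
(* A single upper bound carries both claims, the domination by g / p and the vanishing off the cube;
   the minimum with it settles them at every point. *)
pose u x := p^-1 * (\1_(cube (A * N)) x * g x).
have mc := @measurable_cube R d (A * N).
have m1 : measurable_fun [set: B] ((fun x => \1_(cube (A * N)) x * g x) : B -> R).
  by apply: measurable_funM => //; exact: measurable_indic.
have n1 x : 0 <= \1_(cube (A * N)) x * g x by rewrite mulr_ge0// indicE; case: (_ \in _).
have pV0 : 0 <= p^-1 by rewrite invr_ge0 ltW.
have mu : measurable_fun [set: B] (u : B -> R) by exact: measurable_funM.
have u0 x : 0 <= u x by rewrite mulr_ge0.
have hu D : measurable D -> (\int[lam]_(x in D) (h0 x)%:E <= \int[lam]_(x in D) (u x)%:E)%E.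
  move=> mD; rewrite -hP// condPE//; last exact: mS.
  rewrite /u; under [leRHS]eq_integral do rewrite EFinM.
  rewrite ge0_integralZl_EFin//; last 2 first.
  - by move=> x _; rewrite lee_fin.
  - by apply/measurable_EFinP; exact: measurable_funTS.
  rewrite EFinM; apply: lee_wpmul2l; first by rewrite lee_fin.
  apply: (@le_trans _ _ (pev P (S @^-1` (D `&` cube (A * N))))%:E).
    rewrite lee_fin; apply: le_pev; [apply: measurableI => //; exact: mS|apply: mS; exact: measurableI|].
    by move=> t [Dt Et]; split => //; exact: E_cube.
  rewrite -pevE; last by apply: mS; exact: measurableI.
  rewrite gP; last exact: measurableI.
  rewrite [leLHS]integral_mkcond [leRHS]integral_mkcond le_eqVlt; apply/orP; left; apply/eqP.
  apply: eq_integral => x _; rewrite !patchE in_setI indicE.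
  by case: (x \in D); case: (x \in cube (A * N)); rewrite /= ?mul1r ?mul0r.
have hoo : (\int[lam]_x (h0 x)%:E < +oo)%E.
  by rewrite -hP// preimage_setT probability_setT ltry.
have pos0 := ge0_integral_pos_part mu mh h00 u0 hoo hu.
exists (fun x => Num.min (h0 x) (u x)).
  split; first exact: measurable_minr.
  - by move=> x; rewrite le_min h00 u0.
  - by move=> D mD; rewrite hP//; apply/esym; exact: integral_min_pos_part.
split => x.
  rewrite ge_min; apply/orP; right; rewrite /u ler_wpM2l// indicE.
  by case: (_ \in _); rewrite ?mul1r ?mul0r.
by move=> nc; rewrite /u indicE memNset// mul0r mulr0; apply: min_idPr.
Qed.

Lemma trunc_density_l1 (h : V -> R) : is_density lam Q S h -> (forall x, h x <= p^-1 * g x) -> p <= 1 ->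
  (\int[lam]_x `|h x - g x|%:E <= (2 * (p^-1 - 1))%:E)%E.
Proof.
move=> [mh h0 hP] hg p1; have [mg g0 gP] := gS.
have p1' : 1 <= p^-1 by rewrite invf_ge1.
have int1 : (\int[lam]_x (h x)%:E = 1)%E by rewrite -hP// preimage_setT probability_setT.
have int2 : (\int[lam]_x (g x)%:E = 1)%E by rewrite -gP// preimage_setT probability_setT.
have mabs : measurable_fun [set: B] ((fun x => `|h x - g x|) : B -> R).
  by apply: measurableT_comp => //; exact: measurable_funB.
(* The integrand on the left is 2 max(h, g), which is at most 2 g / p because p is at most 1. As [h]
   and [g] have integral 1, the L1 distance plus 2 is at most 2 / p. *)
have H : (\int[lam]_x (`|h x - g x| + (h x + g x))%:E <= \int[lam]_x ((2 * p^-1)%:E * (g x)%:E))%E.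
  apply: ge0_le_integral => //.
  - by move=> x _; rewrite lee_fin !addr_ge0.
  - by apply/measurable_EFinP; apply: measurable_funD => //; exact: measurable_funD.
  - by apply/measurable_EFinP; exact: measurable_funM.
  - move=> x _; rewrite -EFinM lee_fin -mulrA.
    have gg : g x <= p^-1 * g x by rewrite ler_peMl.
    have := hg x; have := g0 x; have := h0 x.
    by case: (lerP (g x) (h x)) => ?; lra.
rewrite ge0_integralZl_EFin// in H; last 3 first.
- by move=> x _; rewrite lee_fin.
- exact/measurable_EFinP.
- by rewrite mulr_ge0// ltW// invr_gt0.
have mhg : measurable_fun [set: B] ((fun x => h x + g x) : B -> R) by exact: measurable_funD.
have H1 : (\int[lam]_x (`|h x - g x| + (h x + g x))%:E = \int[lam]_x `|h x - g x|%:E + 2%:E)%E.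
  under eq_integral do rewrite EFinD.
  rewrite ge0_integralD//; last 3 first.
  - exact/measurable_EFinP.
  - by move=> x _; rewrite lee_fin addr_ge0.
  - exact/measurable_EFinP.
  congr (_ + _)%E; under eq_integral do rewrite EFinD.
  rewrite ge0_integralD//; last 4 first.
  - by move=> x _; rewrite lee_fin.
  - exact/measurable_EFinP.
  - by move=> x _; rewrite lee_fin.
  - exact/measurable_EFinP.
  by rewrite int1 int2 -EFinD.
move: H; rewrite H1 int2 mule1.
have : (0 <= \int[lam]_x `|h x - g x|%:E)%E by apply: integral_ge0 => x _; rewrite lee_fin.
case: (\int[lam]_x `|h x - g x|%:E)%E => [r _|//|//].
by rewrite -EFinD !lee_fin; lra.
Qed.

End fixed_level.
End truncation.

(** * Passage to the limit *)

Lemma finite_pos_lower_bound {R : realType} (I : finType) (F : I -> R) (c : R) :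
  0 < c -> (forall i, 0 < F i) -> exists2 e : R, 0 < e <= c & forall i, e <= F i.
Proof.
(* The inverse of a sum of inverses lies below every term, and the term for [c] makes this work for
   an empty index type too. *)
move=> c0 F0; pose s := c^-1 + \sum_i (F i)^-1.
have sF i : (F i)^-1 <= s.
  rewrite /s (bigD1 i)//= addrCA lerDl addr_ge0 ?invr_ge0 ?(ltW c0)//.
  by apply: sumr_ge0 => j _; rewrite invr_ge0 ltW.
have sc : c^-1 <= s by rewrite lerDl; apply: sumr_ge0 => j _; rewrite invr_ge0 ltW.
have s0 : 0 < s by apply: lt_le_trans sc; rewrite invr_gt0.
exists s^-1; first by rewrite invr_gt0 s0 -[leRHS]invrK lef_pV2 ?posrE ?invr_gt0.
by move=> i; rewrite -[leRHS]invrK lef_pV2 ?posrE ?invr_gt0.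
Qed.

Theorem theorem1 (R : realType) (d n m : nat) (a : 'M[int]_(n, m))
    (alpha : 'I_n -> R) (lam : {measure set (BorelRd R d) -> \bar R}) :
  lebesgue_Rd lam ->
  (forall i : 'I_n, (\big[gcdn/0%N]_(j < m) `|a i j|%N)%N = 1%N) ->
  \sum_(i < n) alpha i = 0 ->
  (forall (dT : measure_display) (T : measurableType dT) (P : probability T R)
          (U : 'I_m -> T -> 'rV[int]_d),
     (forall j, discrete_rv (U j)) ->
     mutually_independent P [set: set 'rV[int]_d] U ->
     (forall i : 'I_n,
        (shannon_entropy P (fun t => (\sum_(j < m) a i j *: U j t)%R) < +oo)%E) ->
     \sum_(i < n) alpha i
        * fine (shannon_entropy P (fun t => (\sum_(j < m) a i j *: U j t)%R)) <= 0) ->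
  forall (dT : measure_display) (T : measurableType dT) (P : probability T R)
         (X : 'I_m -> T -> 'rV[R]_d),
    (forall j, borel_rv (X j)) ->
    mutually_independent P (@measurable _ (BorelRd R d)) X ->
    (forall j, abs_continuous_rv lam P (X j)) ->
    forall h : 'I_n -> R,
      (forall i : 'I_n,
         diff_entropy_is lam P (fun t => \sum_(j < m) (a i j)%:~R *: X j t) (h i)) ->
      \sum_(i < n) alpha i * h i <= 0.
Proof.
move=> lamE a1 alpha0 Hdisc dT T P X bX iX acX h hE.
have [f fX] := choice (fun j => density_exists (bX j) lamE (acX j)).
have [g gE] := choice hE.
have gS i : is_density lam P (fun t => \sum_(j < m) (a i j)%:~R *: X j t) (g i) by have [] := gE i.
have hg i : h i = fine (\int[lam]_x (eta (g i x))%:E) by have [_ _ <-] := gE i.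
apply/ler_addgt0Pl => e' e'0; rewrite addr0.
pose s : R := \sum_(i < n) `|alpha i|.
have s0 : 0 <= s by exact: sumr_ge0.
(* Each entropy will be off by at most 2e, so the weighted sum is off by at most 2es, which is at
   most e'. *)
pose e := e' / (2 * (s + 1)).
have e0 : 0 < e by rewrite divr_gt0// mulr_gt0// ltr_wpDl.
have /choice[del Hdel] i : exists del : R, 0 < del /\ forall g' : 'rV[R]_d -> R,
    measurable_fun [set: BorelRd R d] (g' : BorelRd R d -> R) -> (forall x, 0 <= g' x <= 2 * g i x) ->
    (\int[lam]_x `|g' x - g i x|%:E <= del%:E)%E ->
    `|fine (\int[lam]_x (eta (g' x))%:E) - fine (\int[lam]_x (eta (g i x))%:E)| <= e.
  have [[mg g0 _] egi _] := gE i.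
  have [del del0 H] := eta_integral_close lamE mg g0 (density_integrable (gS i)) egi e0.
  by exists del; split => // g' mg' gg' l1; have [] := H g' mg' gg' l1.
(* The bound 1 / 2 forces p to be at least 1 / 2, so the conditioned densities are at most twice the
   original ones. The bound [del i / 4] absorbs the factor in the L1 estimate 2 (1 / p - 1), at most
   4 e1. *)
have [||e1 /andP[e10 e12] e1del] := @finite_pos_lower_bound R 'I_n (fun i => del i / 4) (1 / 2).
- by rewrite divr_gt0.
- by move=> i; rewrite divr_gt0//; have [] := Hdel i.
have [N HN] := trunc_event_large bX fX e10.
pose mE := measurable_trunc_event bX fX N; pose p := pev P (trunc_event X f N).
have p12 : 1 / 2 <= p by rewrite -/p in HN; lra.
have p0 : 0 < p by lra.
have p1 : p <= 1 by exact: pev_le1.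
pose Q := condP P mE.
have pV2 : p^-1 <= 2 by rewrite invf_ple ?posrE//; lra.
have pVe : 2 * (p^-1 - 1) <= 4 * e1.
  have -> : p^-1 - 1 = p^-1 * (1 - p) by rewrite mulrBr mulr1 mulVf// gt_eqF.
  have : p^-1 * (1 - p) <= 2 * e1 by apply: ler_pM; rewrite ?invr_ge0; rewrite -/p in HN; lra.
  lra.
have M0 : 0 < N%:R / p + 1 by rewrite ltr_wpDl// divr_ge0// ltW.
pose U k j t := cellv k (X j t).
pose W i k t := lincomb (a i) (fun j => U k j t).
have main i : exists k0, forall k, (k0 <= k)%N -> (0 < k)%N ->
    (shannon_entropy Q (W i k) < +oo)%E /\
    `|fine (shannon_entropy Q (W i k)) - d%:R * ln k%:R - h i| <= 2 * e.
  have [g1 g1S [g1le g1off]] := condP_density_lincomb lamE bX fX p0 (gS i).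
  (* Quantization takes place under [Q], where the densities are bounded and vanish off a cube; [h1]
     is then compared with the original [g i], to which [Hdel] applies. *)
  have [h1 [h1S h10 h1g] H] := bounded_case lamE (a1 i) bX (condP_independent bX iX fX p0)
    (condP_density bX iX fX p0) M0 (trunc_density_le bX iX fX p0)
    (fun j x => @trunc_density_off_cube _ _ _ _ _ P X f N j x) g1S g1off.
  have h1le x : h1 x <= p^-1 * g i x by exact: le_trans (h1g x) (g1le x).
  have [_ gi0 _] := gS i; have [mh1 _ _] := h1S.
  have l1 := trunc_density_l1 p0 (gS i) h1S h1le p1.
  have [_ Hi] := Hdel i.
  have c1 : `|fine (\int[lam]_x (eta (h1 x))%:E) - h i| <= e.
    rewrite hg; apply: Hi => //.
      move=> x; rewrite h10; apply: (le_trans (h1le x)); exact: ler_wpM2r.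
    apply: (le_trans l1); rewrite lee_fin; have := e1del i; lra.
  have [k0 Hk] := H e e0; exists k0 => k kk k1; have [Hoo Hd] := Hk k kk k1.
  split => //; rewrite -(subrKA (fine (\int[lam]_x (eta (h1 x))%:E))).
  by rewrite (le_trans (ler_normD _ _))// mulr2n mulrDl mul1r lerD.
have [k0 Hk] := @eventually_seq _ (enum 'I_n) _ (fun i _ => main i).
pose k := k0.+1.
have {}Hk i := Hk k (leqnSn _) i (mem_enum _ _) (ltn0Sn _).
have UQ : mutually_independent Q [set: set 'rV[int]_d] (U k).
  move=> D _; apply: (condP_independent bX iX fX p0 (B := fun j => cellv k @^-1` D j)) => j.
  exact: measurable_cellv_preimage.
(* A single [k] serves all [i], because the discrete hypothesis concerns one family [U k] for the
   whole weighted sum; its finiteness condition is the first half of [Hk]. *)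
have := Hdisc _ _ Q (U k) (fun j => disc_cellv k (bX j)) UQ (fun i => (Hk i).1).
have -> : \sum_(i < n) alpha i * fine (shannon_entropy Q (fun t => \sum_(j < m) a i j *: U k j t)) =
    \sum_(i < n) alpha i * (fine (shannon_entropy Q (W i k)) - d%:R * ln k%:R).
  under [RHS]eq_bigr do rewrite mulrBr.
  by rewrite sumrB -[X in _ - X]mulr_suml alpha0 mul0r subr0.
move=> Hle.
have : \sum_(i < n) alpha i * h i - \sum_(i < n) alpha i * (fine (shannon_entropy Q (W i k)) - d%:R * ln k%:R)
    <= s * (2 * e).
  rewrite -sumrB mulr_suml; apply: ler_sum => i _; rewrite -mulrBr.
  apply: (le_trans (ler_norm _)); rewrite normrM ler_wpM2l// distrC; exact: (Hk i).2.
have : s * (2 * e) <= e'.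
  have s1 : 0 < s + 1 by rewrite ltr_wpDl.
  have -> : s * (2 * e) = e' * (s / (s + 1)) by rewrite /e; field; rewrite gt_eqF.
  by apply: ler_piMr; [exact: ltW|rewrite ler_pdivrMr// mul1r lerDl].
lra.
Qed.
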